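(* Let $W_1=\mathrm{Tot}(\mathcal O_{\mathbb P^1}(-1)\oplus\mathcal O_{\mathbb P^1}(-1))$ and let $R=H^0(W_1,\mathcal O_{W_1})$. The space $M_1=H^0(W_1,\Lambda^2TW_1)$ of all holomorphic bivector fields on $W_1$ has the following structure as an $R$-module: $$M_1=\langle e_1,e_2,e_3,e_4\rangle/\langle zu_2e_1-zu_1e_2-u_2e_3+u_1e_4\rangle ,$$ that is, $M_1$ is generated over $R$ by the global bivector fields $e_1,e_2,e_3,e_4$ specified in the context, and the module of $R$-linear relations among these generators is generated by the single relation $zu_2e_1-zu_1e_2-u_2e_3+u_1e_4=0$.
   Context: $W_1$ is the complex threefold obtained by gluing $U=\mathbb C^3_{\{z,u_1,u_2\}}$ and $V=\mathbb C^3_{\{\xi,v_1,v_2\}}$ by $(\xi,v_1,v_2)=(z^{-1},zu_1,zu_2)$ where $z,\xi\neq0$. Write $\partial_0=\partial/\partial z$, $\partial_1=\partial/\partial u_1$, $\partial_2=\partial/\partial u_2$. A column vector $(a,b,c)^T$ of functions on $U$ denotes the bivector field $a\,\partial_1\wedge\partial_2+b\,\partial_2\wedge\partial_0+c\,\partial_0\wedge\partial_1$. The global bivector fields $e_i$ are those whose restrictions to $U$ are $$e_1=(0,1,0)^T,\quad e_2=(0,0,1)^T,\quad e_3=(u_1,z,0)^T,\quad e_4=(u_2,0,z)^T.$$ Global functions on $W_1$ are identified with their restrictions to $U$; in particular $u_1,zu_1,u_2,zu_2$ are global functions, and $R$ consists of convergent power series in $1,u_1,zu_1,u_2,zu_2$.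 *)

(* Defs.v *)
From HB Require Import structures.
From mathcomp Require Import all_boot all_order all_algebra.
From mathcomp Require Import boolp classical_sets functions reals.
From mathcomp Require Import topology normedtype derive.
From mathcomp.real_closed Require Export complex.
From mathcomp Require Import ring.
Set Implicit Arguments.
Unset Strict Implicit.
Unset Printing Implicit Defensive.
Import Order.TTheory GRing.Theory Num.Theory.
Import numFieldNormedType.Exports.
Local Open Scope ring_scope.

(* The glued space W_1 makes sense over any numFieldType K; the complex
   threefold is the case K = R[i] with R : realType, where differentiability
   over K at every point is holomorphy.  A global section of a sheaf on W_1 is
   represented by the pair of its restrictions to the charts U and V (both
   equal to K^3), subject to the compatibility on z != 0. *)

Definition row3 (K : pzRingType) (a b c : K) : 'rV[K]_3 :=
  \row_(j < 3) [:: a; b; c]`_j.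

Section Charts.
Variable K : numFieldType.
Local Notation K3 := 'rV[K]_3.

Definition holomorphic (f : K3 -> K) : Prop := forall x, differentiable f x.

(* The transition map (z, u1, u2) |-> (1/z, z u1, z u2) from U to V, used only
   where z != 0. *)
Definition glue (x : K3) : K3 :=
  row3 (x 0 0)^-1 (x 0 0 * x 0 1) (x 0 0 * x 0 2).

Definition is_W1fun (f : (K3 -> K) * (K3 -> K)) : Prop :=
  [/\ holomorphic f.1, holomorphic f.2 &
      forall x : K3, x 0 0 != 0 -> f.1 x = f.2 (glue x)].

(* Tangent vectors are row vectors, so that the differential of a map phi at x
   sends v to [v *m jacobian phi x]; bivectors are antisymmetric matrices. *)
Definition wedge (v w : K3) : 'M[K]_3 := v^T *m w - w^T *m v.

Definition bivec (a b c : K) : 'M[K]_3 :=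
  let d i : K3 := delta_mx 0 i in
  a *: wedge (d 1) (d 2) + b *: wedge (d 2) (d 0) + c *: wedge (d 0) (d 1).

Definition push_bivec (phi : K3 -> K3) (x : K3) (B : 'M[K]_3) : 'M[K]_3 :=
  (jacobian phi x)^T *m B *m jacobian phi x.

Definition bivec_field (B : K3 -> 'M[K]_3) : Prop :=
  (forall x, (B x)^T = - B x) /\ (forall i j, holomorphic (fun x => B x i j)).

Definition is_W1bivec (B : (K3 -> 'M[K]_3) * (K3 -> 'M[K]_3)) : Prop :=
  [/\ bivec_field B.1, bivec_field B.2 &
      forall x : K3, x 0 0 != 0 -> B.2 (glue x) = push_bivec glue x (B.1 x)].

Lemma push_bivec_wedge (phi : K3 -> K3) x v w :
  differentiable phi x ->
  push_bivec phi x (wedge v w) = wedge ('d phi x v) ('d phi x w).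
Proof.
move=> dphi; rewrite -!deriveE // !deriveEjacobian // /push_bivec /wedge.
by rewrite mulmxBr mulmxBl !trmx_mul !mulmxA.
Qed.

End Charts.

Section Ring.
Variable K : numFieldType.
Local Notation K3 := 'rV[K]_3.

Definition W1fun_pred : {pred (K3 -> K) * (K3 -> K)} :=
  fun f => `[< is_W1fun f >].

Record W1fun := MkW1fun { W1fun_val :> (K3 -> K) * (K3 -> K);
                          _ : W1fun_val \in W1fun_pred }.

HB.instance Definition _ := [isSub for W1fun_val].
HB.instance Definition _ := [Choice of W1fun by <:].

Lemma W1fun_subring : subring_closed W1fun_pred.
Proof.
split=> [|f g /asboolP[f1 f2 fg] /asboolP[g1 g2 gg]
         |f g /asboolP[f1 f2 fg] /asboolP[g1 g2 gg]]; apply/asboolP.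
- by split=> // x; exact: differentiable_cst.
- split=> x; [exact: differentiableB|exact: differentiableB|].
  by move=> x0; congr (_ - _); [exact: fg|exact: gg].
- split=> x; [exact: differentiableM|exact: differentiableM|].
  by move=> x0; congr (_ * _); [exact: fg|exact: gg].
Qed.

HB.instance Definition _ :=
  GRing.isSubringClosed.Build _ W1fun_pred W1fun_subring.
HB.instance Definition _ := [SubChoice_isSubComNzRing of W1fun by <:].

Lemma W1funP (f : W1fun) : is_W1fun (W1fun_val f).
Proof. by case: f => f /= /asboolP. Qed.

End Ring.

Section Bivectors.
Variable K : numFieldType.
Local Notation K3 := 'rV[K]_3.

Definition W1bivec_pred : {pred (K3 -> 'M[K]_3) * (K3 -> 'M[K]_3)} :=
  fun B => `[< is_W1bivec B >].

Record W1bivec := MkW1bivec {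
  W1bivec_val :> (K3 -> 'M[K]_3) * (K3 -> 'M[K]_3);
  _ : W1bivec_val \in W1bivec_pred }.

HB.instance Definition _ := [isSub for W1bivec_val].
HB.instance Definition _ := [Choice of W1bivec by <:].

Lemma bivec_fieldB B D : bivec_field B -> bivec_field D ->
  bivec_field (B - D : K3 -> 'M[K]_3).
Proof.
move=> [Ba Bh] [Da Dh]; split=> [x|i j].
  by rewrite [(B - D) x]/(B x - D x) linearB /= Ba Da opprD.
have -> : (fun x => (B - D) x i j) = (fun x => B x i j) - (fun x => D x i j).
  by apply/funext => x; rewrite !mxE.
by move=> x; apply: differentiableB; [exact: Bh|exact: Dh].
Qed.

Lemma W1bivec_zmod : zmod_closed W1bivec_pred.
Proof.
split=> [|B D /asboolP[B1 B2 BB] /asboolP[D1 D2 DD]]; apply/asboolP.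
  have z : bivec_field (0 : K3 -> 'M[K]_3).
    split=> [x|i j x]; first by rewrite trmx0 oppr0.
    have -> : (fun x => (0 : K3 -> 'M[K]_3) x i j) = cst 0.
      by apply/funext => y; rewrite mxE.
    exact: differentiable_cst.
  by split=> // x _; rewrite /push_bivec mulmx0 mul0mx.
split; [exact: bivec_fieldB|exact: bivec_fieldB|move=> x x0].
rewrite [LHS]/(B.2 (glue x) - D.2 (glue x)) BB // DD //.
by rewrite /push_bivec [in RHS]mulmxBr mulmxBl.
Qed.

HB.instance Definition _ :=
  GRing.isZmodClosed.Build _ W1bivec_pred W1bivec_zmod.
HB.instance Definition _ := [SubChoice_isSubZmodule of W1bivec by <:].

Lemma W1bivecP (B : W1bivec) : is_W1bivec (W1bivec_val B).
Proof. by case: B => B /= /asboolP. Qed.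

Lemma bivec_fieldZ (f : K3 -> K) B : holomorphic f -> bivec_field B ->
  bivec_field (fun x => f x *: B x).
Proof.
move=> fh [Ba Bh]; split=> [x|i j]; first by rewrite linearZ /= Ba scalerN.
have -> : (fun x => (f x *: B x) i j) = f * (fun x => B x i j).
  by apply/funext => x; rewrite !mxE.
by move=> x; apply: differentiableM; [exact: fh|exact: Bh].
Qed.

Fact W1scale_subproof (f : W1fun K) (B : W1bivec) :
  (fun x => f.1 x *: B.1 x, fun x => f.2 x *: B.2 x) \in W1bivec_pred.
Proof.
have [f1 f2 ff] := W1funP f; have [B1 B2 BB] := W1bivecP B.
apply/asboolP; split=> [||x x0] /=; [exact: bivec_fieldZ..|].
by rewrite BB // ff // /push_bivec -scalemxAr -scalemxAl.
Qed.

Definition W1scale f B := MkW1bivec (W1scale_subproof f B).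

Fact W1scaleA f g B : W1scale f (W1scale g B) = W1scale (f * g) B.
Proof.
by apply: val_inj; congr (_, _); apply/funext => x /=; rewrite scalerA.
Qed.

Fact W1scale1 : left_id 1 W1scale.
Proof.
move=> B; apply: val_inj; rewrite [RHS]surjective_pairing.
by congr (_, _); apply/funext => x /=; exact: scale1r.
Qed.

Fact W1scaleDr : right_distributive W1scale +%R.
Proof.
move=> f B D; apply: val_inj.
by congr (_, _); apply/funext => x /=; exact: scalerDr.
Qed.

Fact W1scaleDl B : {morph W1scale^~ B : f g / f + g}.
Proof.
move=> f g; apply: val_inj.
by congr (_, _); apply/funext => x /=; exact: scalerDl.
Qed.

HB.instance Definition _ := GRing.Zmodule_isLmodule.Build (W1fun K) W1bivec
  W1scaleA W1scale1 W1scaleDr W1scaleDl.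

End Bivectors.

Section Elements.
Variable K : numFieldType.
Local Notation K3 := 'rV[K]_3.

Lemma holomorphic_coord j : holomorphic (fun x : K3 => x 0 j).
Proof. by move=> x; exact: differentiable_coord. Qed.

Lemma holomorphicM (f g : K3 -> K) :
  holomorphic f -> holomorphic g -> holomorphic (fun x => f x * g x).
Proof. by move=> fh gh x; exact: differentiableM. Qed.

Lemma holomorphicN (f : K3 -> K) : holomorphic f -> holomorphic (fun x => - f x).
Proof. by move=> fh x; exact: differentiableN. Qed.

Lemma holomorphic_cst (a : K) : holomorphic (fun _ : K3 => a).
Proof. by move=> x; exact: differentiable_cst. Qed.

Lemma glueE (x : K3) : (glue x 0 0 = (x 0 0)^-1) *
  (glue x 0 1 = x 0 0 * x 0 1) * (glue x 0 2 = x 0 0 * x 0 2).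
Proof. by rewrite !mxE. Qed.

Local Hint Extern 0 (holomorphic _) =>
  solve [repeat first [exact: holomorphic_coord|exact: holomorphic_cst
        |apply: holomorphicM|apply: holomorphicN]] : core.

Fact W1u_subproof (j : 'I_3) : j != 0 ->
  (fun x : K3 => x 0 j, fun y : K3 => y 0 0 * y 0 j) \in @W1fun_pred K.
Proof.
move=> j0; apply/asboolP; split=> //= x x0; rewrite glueE.
have [->|->] : j = 1 \/ j = 2.
- by case: j j0 => -[|[|[|//]]] ? // _; [left|right]; apply: val_inj.
- by rewrite glueE mulKf.
- by rewrite glueE mulKf.
Qed.

Fact W1zu_subproof (j : 'I_3) : j != 0 ->
  (fun x : K3 => x 0 0 * x 0 j, fun y : K3 => y 0 j) \in @W1fun_pred K.
Proof.
move=> j0; apply/asboolP; split=> //= x x0.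
have [->|->] : j = 1 \/ j = 2.
- by case: j j0 => -[|[|[|//]]] ? // _; [left|right]; apply: val_inj.
- by rewrite glueE.
- by rewrite glueE.
Qed.

Definition W1u1 : W1fun K := MkW1fun (@W1u_subproof 1 isT).
Definition W1u2 : W1fun K := MkW1fun (@W1u_subproof 2 isT).
Definition W1zu1 : W1fun K := MkW1fun (@W1zu_subproof 1 isT).
Definition W1zu2 : W1fun K := MkW1fun (@W1zu_subproof 2 isT).

Lemma bivecE (a b c : K) (i j : 'I_3) : bivec a b c i j =
  (nth [::] [:: [:: 0; c; - b]; [:: - c; 0; a]; [:: b; - a; 0]] i)`_j.
Proof.
rewrite /bivec /wedge !mxE !big_ord1 !mxE.
case: i => -[|[|[|//]]] ?; case: j => -[|[|[|//]]] ? /=; ring.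
Qed.

Lemma bivec_field_bivec (a b c : K3 -> K) :
  holomorphic a -> holomorphic b -> holomorphic c ->
  bivec_field (fun x : K3 => bivec (a x) (b x) (c x)).
Proof.
move=> ah bh ch; split=> [x|i j].
  apply/matrixP => i j; rewrite [LHS]mxE [RHS]mxE !bivecE.
  by case: i => -[|[|[|//]]] ?; case: j => -[|[|[|//]]] ? /=;
     rewrite ?opprK ?oppr0.
have -> : (fun x : K3 => bivec (a x) (b x) (c x) i j) = (fun x =>
    (nth [::] [:: [:: 0; c x; - b x]; [:: - c x; 0; a x];
                  [:: b x; - a x; 0]] i)`_j).
  by apply/funext => x; exact: bivecE.
by case: i => -[|[|[|//]]] ?; case: j => -[|[|[|//]]] ? /=;
  auto using holomorphicN.
Qed.

Lemma diff_coord (phi : K3 -> K3) x v j : differentiable phi x ->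
  'd phi x v 0 j = 'd (fun y => phi y 0 j) x v.
Proof.
move=> dphi.
have @f : {linear K3 -> K}.
  by exists (fun N : K3 => N 0 j); do 2![eexists]; do ?[constructor];
     rewrite ?mxE// => ? *; rewrite ?mxE//; move=> ?; rewrite !mxE.
have fc : continuous f by exact: coord_continuous.
rewrite [in RHS](_ : (fun y => phi y 0 j) = f \o phi) //.
have df : differentiable f (phi x) by exact: linear_differentiable.
have /(congr1 (@^~ v)) -> := diff_comp dphi df.
exact/esym/(congr1 (@^~ ('d phi x v)) (diff_lin (phi x) fc)).
Qed.

Lemma differentiable_glue (x : K3) : x 0 0 != 0 -> differentiable (@glue K) x.
Proof.
move=> x0; have -> : @glue K = fun y =>
    (y 0 0)^-1 *: delta_mx 0 0 + ((y 0 0 * y 0 1) *: delta_mx 0 1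
      + (y 0 0 * y 0 2) *: delta_mx 0 2).
  apply/funext => y; apply/rowP => j; rewrite !mxE.
  by case: j => -[|[|[|//]]] ? /=; rewrite ?(mulr0, mulr1, addr0, add0r).
do ?[apply: differentiableD]; apply: differentiableZl.
- by apply: differentiableV => //; exact: differentiable_coord.
- by apply: differentiableM; exact: differentiable_coord.
- by apply: differentiableM; exact: differentiable_coord.
Qed.

Lemma diff_glue (x v : K3) : x 0 0 != 0 -> 'd (@glue K) x v =
  row3 (- (x 0 0) ^- 2 * v 0 0) (x 0 0 * v 0 1 + x 0 1 * v 0 0)
       (x 0 0 * v 0 2 + x 0 2 * v 0 0).
Proof.
move=> x0.
have dc j : 'd (fun y : K3 => y 0 j) x v = v 0 j.
  by rewrite -(diff_coord (phi := id)) // diff_val.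
apply/rowP => j; rewrite diff_coord; last exact: differentiable_glue.
have dM k : 'd (fun y : K3 => y 0 0 * y 0 k) x v
    = x 0 0 * v 0 k + x 0 k * v 0 0.
  rewrite -(dc k) -(dc 0).
  exact: (congr1 (@^~ v) (diffM (differentiable_coord x 0 0)
                                (differentiable_coord x 0 k))).
have [->|[->|->]] : j = 0 \/ j = 1 \/ j = 2.
- by case: j => -[|[|[|//]]] ?; [left|right; left|right; right]; apply: val_inj.
- have -> : (fun y : K3 => glue y 0 0) = (fun y => (y 0 0)^-1).
    by apply/funext => y; rewrite glueE.
  rewrite mxE /= -(dc 0).
  exact: (congr1 (@^~ v) (diffV (differentiable_coord x 0 0) x0)).
- have -> : (fun y : K3 => glue y 0 1) = (fun y => y 0 0 * y 0 1).
    by apply/funext => y; rewrite glueE.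
  by rewrite dM mxE.
- have -> : (fun y : K3 => glue y 0 2) = (fun y => y 0 0 * y 0 2).
    by apply/funext => y; rewrite glueE.
  by rewrite dM mxE.
Qed.

Lemma diff_glue_basis (x : K3) (k : 'I_3) : x 0 0 != 0 ->
  'd (@glue K) x (delta_mx 0 k) =
  [:: row3 (- (x 0 0) ^- 2) (x 0 1) (x 0 2); row3 0 (x 0 0) 0;
      row3 0 0 (x 0 0)]`_k.
Proof.
move=> x0; rewrite diff_glue // !mxE.
by case: k => -[|[|[|//]]] ? /=; rewrite ?(mulr0, mulr1, addr0, add0r).
Qed.

Lemma push_bivec_glue (x : K3) (a b c : K) : x 0 0 != 0 ->
  push_bivec (@glue K) x (bivec a b c) =
  bivec ((x 0 0) ^+ 2 * a - x 0 0 * x 0 1 * b - x 0 0 * x 0 2 * c)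
        (- (x 0 0)^-1 * b) (- (x 0 0)^-1 * c).
Proof.
move=> x0; have dg := differentiable_glue x0.
have pD B D : push_bivec (@glue K) x (B + D) =
    push_bivec (@glue K) x B + push_bivec (@glue K) x D.
  by rewrite /push_bivec mulmxDr mulmxDl.
have pZ s B : push_bivec (@glue K) x (s *: B) = s *: push_bivec (@glue K) x B.
  by rewrite /push_bivec -scalemxAr -scalemxAl.
rewrite {1}/bivec !pD !pZ !push_bivec_wedge // !diff_glue_basis //=.
apply/matrixP => i j; rewrite bivecE /wedge !mxE !big_ord1 !mxE.
by case: i => -[|[|[|//]]] ?; case: j => -[|[|[|//]]] ? /=; field.
Qed.

Fact W1bivec_subproof (a b c a' b' c' : K3 -> K) :
  holomorphic a -> holomorphic b -> holomorphic c ->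
  holomorphic a' -> holomorphic b' -> holomorphic c' ->
  (forall x : K3, x 0 0 != 0 -> [/\
     a' (glue x) = (x 0 0) ^+ 2 * a x - x 0 0 * x 0 1 * b x
                   - x 0 0 * x 0 2 * c x,
     b' (glue x) = - (x 0 0)^-1 * b x & c' (glue x) = - (x 0 0)^-1 * c x]) ->
  (fun x : K3 => bivec (a x) (b x) (c x), fun y : K3 => bivec (a' y) (b' y) (c' y))
    \in @W1bivec_pred K.
Proof.
move=> ah bh ch ah' bh' ch' E; apply/asboolP; split; [exact: bivec_field_bivec..|].
by move=> x x0 /=; rewrite push_bivec_glue //; have [-> -> ->] := E x x0.
Qed.

(* The second components are the restrictions to V, in the coordinates
   (xi, v1, v2); they are forced by the first ones. *)
Fact e1_subproof :
  (fun x : K3 => bivec 0 1 0, fun y : K3 => bivec (- y 0 1) (- y 0 0) 0)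
    \in @W1bivec_pred K.
Proof.
apply: (W1bivec_subproof (a := fun=> 0) (b := fun=> 1) (c := fun=> 0)
  (a' := fun y : K3 => - y 0 1) (b' := fun y : K3 => - y 0 0) (c' := fun=> 0)); auto.
by move=> x x0; rewrite !glueE; split; field.
Qed.

Fact e2_subproof :
  (fun x : K3 => bivec 0 0 1, fun y : K3 => bivec (- y 0 2) 0 (- y 0 0))
    \in @W1bivec_pred K.
Proof.
apply: (W1bivec_subproof (a := fun=> 0) (b := fun=> 0) (c := fun=> 1)
  (a' := fun y : K3 => - y 0 2) (b' := fun=> 0) (c' := fun y : K3 => - y 0 0)); auto.
by move=> x x0; rewrite !glueE; split; field.
Qed.

Fact e3_subproof :
  (fun x : K3 => bivec (x 0 1) (x 0 0) 0, fun y : K3 => bivec 0 (- 1) 0)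
    \in @W1bivec_pred K.
Proof.
apply: (W1bivec_subproof (a := fun x : K3 => x 0 1) (b := fun x : K3 => x 0 0)
  (c := fun=> 0) (a' := fun=> 0) (b' := fun=> - 1) (c' := fun=> 0)); auto.
by move=> x x0; split; field.
Qed.

Fact e4_subproof :
  (fun x : K3 => bivec (x 0 2) 0 (x 0 0), fun y : K3 => bivec 0 0 (- 1))
    \in @W1bivec_pred K.
Proof.
apply: (W1bivec_subproof (a := fun x : K3 => x 0 2) (b := fun=> 0)
  (c := fun x : K3 => x 0 0) (a' := fun=> 0) (b' := fun=> 0) (c' := fun=> - 1)); auto.
by move=> x x0; split; field.
Qed.

Definition e1 : W1bivec K := MkW1bivec e1_subproof.
Definition e2 : W1bivec K := MkW1bivec e2_subproof.
Definition e3 : W1bivec K := MkW1bivec e3_subproof.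
Definition e4 : W1bivec K := MkW1bivec e4_subproof.

End Elements.

(* Main.v *)
From HB Require Import structures.
Require Import Defs.
From mathcomp Require Import all_boot all_order all_algebra.
From mathcomp Require Import boolp classical_sets functions reals.
From mathcomp Require Import constructive_ereal interval_inference.
From mathcomp Require Import topology normedtype derive landau.
From mathcomp Require Import measure lebesgue_measure lebesgue_integral.
From mathcomp.real_closed Require Import complex.
From mathcomp Require Import ring lra.
Set Implicit Arguments.
Unset Strict Implicit.
Unset Printing Implicit Defensive.
Import Order.TTheory GRing.Theory Num.Theory.
Import numFieldNormedType.Exports.
Local Open Scope classical_set_scope.
Local Open Scope complex_scope.
Local Open Scope ring_scope.

(** Write z, u1, u2 and xi, v1, v2 for the coordinates of the two charts.  A
    bivector field (a, b, c) on U and its restriction (a', b', c') to V satisfy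
<<
      a' = z^2 a - z u1 b - z u2 c,    b' = - b / z,    c' = - c / z
>>
    on the overlap, so that b and c are sections of the pullback of O(1) and,
    once b and c vanish, a is a section of the pullback of O(-2).

    Generation.  A section (b, b') of O(1) is f + z g with f and g global:
    take g = - b'(0, v1, v2); then b' + g vanishes on xi = 0, and dividing it
    by xi gives - f on V ([split_O1]).  Subtracting f e1 + g e3 and the
    analogous terms for c leaves a field (r, 0, 0).  On the zero section r is a
    section of O(-2) on the projective line, hence 0 ([no_section_Ominus2]), and
    division by u1 and then by u2 writes r = u1 s1 + u2 s2 with s1, s2, z s1
    and z s2 all global ([split_Ominus2]).  Finally
    (r, 0, 0) = - z s1 e1 - z s2 e2 + s1 e3 + s2 e4.

    Relations.  If the combination with coefficients a1, .., a4 is 0, then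
    u1 a3 + u2 a4 = 0, a1 = - z a3 and a2 = - z a4 on U.  So a4 vanishes on
    u1 = 0, and s = a4 / u1 is the required multiplier; on V it is
    - a2 / v1 ([relations]).

    Both halves rest on one analytic fact, [holomorphic_division]: a function
    that is complex differentiable at every point of C^3 and vanishes on a
    coordinate hyperplane is that coordinate times such a function.  As
    holomorphy only means pointwise differentiability, this needs Cauchy's
    theory in one variable.  The bisection argument of Goursat shows that the
    integral over the boundary of a rectangle vanishes ([goursat]); comparing
    a large square with small ones gives the Cauchy formula, with the winding
    number of the unit square as its constant; expanding the Cauchy kernel
    gives Taylor estimates whose constants depend only on a bound for the
    function ([taylor], [cauchy_estimate]), and from these the removable
    singularity theorem.  The same uniform estimates show that a locally
    bounded function that is holomorphic in each coordinate is differentiable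
    ([osgood]), which is how the quotient is seen to be holomorphic. *)

Local Notation Re := complex.Re.
Local Notation Im := complex.Im.

(** * The modulus and complex differentiability in terms of real radii *)

(** Viewing the complex numbers as a normed module over themselves gives them the
    norm topology, in which maps between them can be differentiated. *)
HB.instance Definition _ (R : realType) :=
  NormedModule.copy R[i] (R[i])^o.

Section Modulus.
Variable R : realType.
Local Notation C := R[i].
Implicit Types z w : C.

Local Notation N := (@Normc.normc R).

Lemma normrc z : `|z| = (N z)%:C.
Proof. by []. Qed.

Lemma normc_ge0 z : 0 <= N z.
Proof. by rewrite -ler0c -normrc. Qed.

Lemma normcD z w : N (z + w) <= N z + N w.
Proof. exact: le_normcD. Qed.

Lemma normcN z : N (- z) = N z.
Proof. exact: normcN. Qed.

Lemma normcBC z w : N (z - w) = N (w - z).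
Proof. by rewrite -normcN opprB. Qed.

Lemma normcB z w : N (z - w) <= N z + N w.
Proof. by rewrite -(normcN w); exact: normcD. Qed.

Lemma normcB_ge z w : N z - N w <= N (z - w).
Proof. by rewrite lerBlDr -{1}(subrK w z); exact: normcD. Qed.

Lemma normc_real (x : R) : N x%:C = `|x|.
Proof. by rewrite /= expr0n addr0 sqrtr_sqr. Qed.

Lemma normc_i : N 'i = 1.
Proof. by rewrite /= expr0n expr1n add0r sqrtr1. Qed.

Lemma normc_eq0 z : (N z == 0) = (z == 0).
Proof.
apply/eqP/eqP => [/Normc.eq0_normc //|->]; exact: Normc.normc0.
Qed.

Lemma normc_gt0 z : (0 < N z) = (z != 0).
Proof. by rewrite lt_neqAle normc_ge0 andbT eq_sym normc_eq0. Qed.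

Lemma normcX z n : N (z ^+ n) = N z ^+ n.
Proof.
elim: n => [|n IH]; first by rewrite !expr0 Normc.normc1.
by rewrite !exprS Normc.normcM IH.
Qed.

Lemma normc_geRe z : `|Re z| <= N z.
Proof. by rewrite -lecR; exact: normc_ge_Re. Qed.

Lemma normc_geIm z : `|Im z| <= N z.
Proof.
case: z => a b /=; rewrite -sqrtr_sqr ler_sqrt; last first.
  by rewrite addr_ge0 ?sqr_ge0.
by rewrite lerDr sqr_ge0.
Qed.

Lemma normc_leReIm z : N z <= `|Re z| + `|Im z|.
Proof.
have -> : z = (Re z)%:C + 'i * (Im z)%:C by exact: complexE.
apply: le_trans (normcD _ _) _.
rewrite Normc.normcM !normc_real normc_i mul1r; case: z => a b /=.
by rewrite !(mul0r,mulr0,mul1r,addr0,add0r,subr0).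
Qed.

Lemma cReD z w : Re (z + w) = Re z + Re w. Proof. by case: z; case: w. Qed.
Lemma cImD z w : Im (z + w) = Im z + Im w. Proof. by case: z; case: w. Qed.
Lemma cReN z : Re (- z) = - Re z. Proof. by case: z. Qed.
Lemma cImN z : Im (- z) = - Im z. Proof. by case: z. Qed.
Lemma cReM z w : Re (z * w) = Re z * Re w - Im z * Im w.
Proof. by case: z; case: w. Qed.
Lemma cImM z w : Im (z * w) = Re z * Im w + Im z * Re w.
Proof. by case: z; case: w. Qed.
Definition cReImE := (cReD, cImD, cReN, cImN, cReM, cImM).

Lemma complex_eqP z w : Re z = Re w -> Im z = Im w -> z = w.
Proof. by case: z; case: w => a b c d /= -> ->. Qed.

Lemma cpos_real (e : C) : 0 < e -> exists2 r : R, 0 < r & e = r%:C.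
Proof. by case: e => a b; rewrite ltcE /= => /andP[/eqP -> a0]; exists a. Qed.

Lemma nbhs_radius (T : normedModType C) (x : T) (P : T -> Prop) :
  (exists2 d : R, 0 < d & forall y, `|y - x| < d%:C -> P y) ->
  \forall y \near x, P y.
Proof.
move=> [d d0 H]; apply/nbhs_ballP; exists d%:C => /=; first by rewrite ltcR.
by move=> y; rewrite -ball_normE /= -opprB normrN => /H.
Qed.

Lemma radius_nbhs (T : normedModType C) (x : T) (P : T -> Prop) :
  (\forall y \near x, P y) ->
  exists2 d : R, 0 < d & forall y, `|y - x| < d%:C -> P y.
Proof.
move=> /nbhs_ballP[e /= /cpos_real[d d0 ->] H]; exists d => // y yd.
by apply: H; rewrite -ball_normE /= -opprB normrN.
Qed.

Lemma continuous_epsP (T : normedModType C) (f : T -> C) x :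
  {for x, continuous f} <->
  forall e : R, 0 < e ->
    exists2 d : R, 0 < d & forall y, `|y - x| < d%:C -> N (f y - f x) < e.
Proof.
split=> [fx e e0|H].
  have /cvgrPdist_lt/(_ e%:C) := fx; rewrite ltcR => /(_ e0)/radius_nbhs[d d0 Hd].
  exists d => // y /Hd; rewrite /= ltcR; by rewrite normcBC.
apply/cvgrPdist_lt => _ /cpos_real[e e0 ->].
have [d d0 Hd] := H e e0; apply: nbhs_radius; exists d => // y /Hd.
by rewrite normrc ltcR normcBC.
Qed.

Lemma differentiable_eps (T : normedModType C) (f : T -> C) x :
  differentiable f x ->
  forall e : R, 0 < e -> exists2 d : R, 0 < d & forall h : T, `|h| < d%:C ->
    `|f (x + h) - f x - 'd f x h| <= e%:C * `|h|.
Proof.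
move=> df e e0.
have := diff_locally df => /eqaddoP /(_ e%:C); rewrite ltcR => /(_ e0).
move=> /radius_nbhs[d d0 H]; exists d => // h hd.
have := H h; rewrite subr0 => /(_ hd) /=.
by rewrite -[(_ - _) h]/(_ - (cst (f x) + 'd f x) h) /= [h + x]addrC opprD addrA.
Qed.

Lemma eps_differentiable (T : normedModType C) (f : T -> C) (L : {linear T -> C}) x :
  continuous L ->
  (forall e : R, 0 < e -> exists2 d : R, 0 < d & forall h : T, `|h| < d%:C ->
    `|f (x + h) - f x - L h| <= e%:C * `|h|) ->
  differentiable f x.
Proof.
move=> Lc H.
have E : f \o shift x = cst (f x) + L +o_ 0 id.
  apply/eqaddoP => _ /cpos_real[e e0 ->]; apply: nbhs_radius.
  have [d d0 Hd] := H e e0; exists d => // h; rewrite subr0 => /Hd.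
  by rewrite -[(_ - _) h]/(_ - (cst (f x) + L) h) /= [h + x]addrC opprD addrA.
by apply/diff_locallyP; rewrite (diff_unique Lc E); split.
Qed.

Lemma derive1_eps (f : C -> C) (z : C) : differentiable f z ->
  forall e : R, 0 < e -> exists2 d : R, 0 < d & forall h, N h < d ->
    N (f (z + h) - f z - derive1 f z * h) <= e * N h.
Proof.
move=> df e e0; have [d d0 H] := differentiable_eps df e0; exists d => // h hd.
have := H h; rewrite normrc ltcR => /(_ hd).
have -> : 'd f z h = derive1 f z * h.
  by rewrite derive1E deriveE // -[h in LHS]mulr1 [h * 1]/(h *: 1) linearZ /= mulrC.
by rewrite !normrc -rmorphM lecR.
Qed.

Lemma eps_derive1 (f : C -> C) (z c : C) :
  (forall e : R, 0 < e -> exists2 d : R, 0 < d & forall h, N h < d ->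
    N (f (z + h) - f z - c * h) <= e * N h) ->
  differentiable f z.
Proof.
move=> H; apply: (@eps_differentiable C f ( c \*: idfun)).
  by move=> x; exact: (@mulrl_continuous C c x).
move=> e e0; have [d d0 Hd] := H e e0; exists d => // h.
by rewrite !normrc ltcR => /Hd; rewrite -rmorphM lecR.
Qed.

(** The form in which derivatives are found below: the Cauchy estimates bound
    the remainder by the square of the increment. *)
Lemma quadratic_remainder (f : C -> C) (z c : C) (d K : R) : 0 < d ->
  (forall h, N h < d -> N (f (z + h) - f z - c * h) <= K * N h ^+ 2) ->
  differentiable f z /\ derive1 f z = c.
Proof.
move=> d0 H.
have H' : forall e : R, 0 < e -> exists2 d : R, 0 < d & forall h, N h < d ->
    N (f (z + h) - f z - c * h) <= e * N h.
  move=> e e0; have K0 : 0 < `|K| + 1 by rewrite ltr_wpDl.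
  exists (Num.min d (e / (`|K| + 1))).
    by rewrite lt_min d0 divr_gt0.
  move=> h; rewrite lt_min => /andP[hd he]; apply: le_trans (H h hd) _.
  rewrite expr2 mulrA ler_wpM2r ?normc_ge0 //.
  move: he; rewrite ltr_pdivlMr // => he; apply: le_trans (ltW he).
  rewrite mulrC ler_wpM2l ?normc_ge0 //.
  by have := ler_norm K; lra.
have df : differentiable f z by exact: eps_derive1 H'.
split=> //; apply/eqP; rewrite -subr_eq0 -normc_eq0; apply/eqP/le_anti.
rewrite normc_ge0 andbT leNgt; apply/negP => D0; set D := N _ in D0.
have e0 : 0 < D / 4 by rewrite divr_gt0.
have [d1 d10 H1] := H' _ e0; have [d2 d20 H2] := derive1_eps df e0.
pose h : C := (Num.min d1 d2 / 2)%:C.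
have h0 : 0 < Num.min d1 d2 by rewrite lt_min d10.
have Nh : N h = Num.min d1 d2 / 2.
  by rewrite normc_real ger0_norm // divr_ge0 // ltW.
have hd : N h < Num.min d1 d2 by rewrite Nh; lra.
move: (hd); rewrite lt_min => /andP[/H1 h1 /H2 h2].
have : N ((derive1 f z - c) * h) <= N (f (z + h) - f z - c * h) +
    N (f (z + h) - f z - derive1 f z * h).
  rewrite (_ : (derive1 f z - c) * h = (f (z + h) - f z - c * h) -
    (f (z + h) - f z - derive1 f z * h)); first exact: normcB.
  by ring.
rewrite Normc.normcM -/D Nh in h1 h2 *; nra.
Qed.

End Modulus.

(** * Integrals over segments and boundaries of rectangles *)

Section Integral.
Variable R : realType.
Local Notation C := R[i].
Local Notation N := (@Normc.normc R).
Local Notation mu := (@lebesgue_measure R).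
Implicit Types (g : R -> C) (a b : R).

Definition continuous_seg g a b :=
  forall t, a <= t <= b -> {for t, continuous g}.

Definition seg_int g a b : C :=
  (\int[mu]_(t in `[a, b]) Re (g t)) +i* (\int[mu]_(t in `[a, b]) Im (g t)).

Lemma Re_continuous g t : {for t, continuous g} ->
  {for t, continuous (fun s => Re (g s))}.
Proof.
move=> gt; apply/cvgrPdist_lt => e e0.
have /cvgrPdist_lt/(_ e%:C) := gt; rewrite ltcR => /(_ e0); apply: filterS => s.
rewrite normrc ltcR; apply: le_lt_trans; rewrite -cReN -cReD; exact: normc_geRe.
Qed.

Lemma Im_continuous g t : {for t, continuous g} ->
  {for t, continuous (fun s => Im (g s))}.
Proof.
move=> gt; apply/cvgrPdist_lt => e e0.
have /cvgrPdist_lt/(_ e%:C) := gt; rewrite ltcR => /(_ e0); apply: filterS => s.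
rewrite normrc ltcR; apply: le_lt_trans; rewrite -cImN -cImD; exact: normc_geIm.
Qed.

Lemma integrable_seg (f : R -> R) a b :
  (forall t, a <= t <= b -> {for t, continuous f}) ->
  mu.-integrable `[a, b] (EFin \o f).
Proof.
move=> fc; apply: continuous_compact_integrable; first exact: segment_compact.
by apply: continuous_in_subspaceT => t /set_mem /=; rewrite in_itv; exact: fc.
Qed.

Lemma integrable_Re g a b : continuous_seg g a b ->
  mu.-integrable `[a, b] (EFin \o (fun t => Re (g t))).
Proof. by move=> gc; apply: integrable_seg => t /gc; exact: Re_continuous. Qed.

Lemma integrable_Im g a b : continuous_seg g a b ->
  mu.-integrable `[a, b] (EFin \o (fun t => Im (g t))).
Proof. by move=> gc; apply: integrable_seg => t /gc; exact: Im_continuous. Qed.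

Lemma eq_seg_int g1 g2 a b : (forall t, a <= t <= b -> g1 t = g2 t) ->
  seg_int g1 a b = seg_int g2 a b.
Proof.
move=> E; congr (_ +i* _); apply: eq_Rintegral => t /set_mem /=;
  by rewrite in_itv => /E ->.
Qed.

Lemma Rintegral_seg_cst a b (k : R) : a <= b ->
  \int[mu]_(t in `[a, b]) k = k * (b - a).
Proof.
move=> ab; rewrite Rintegral_cst //= lebesgue_measure_itv /= lte_fin.
move: ab; rewrite le_eqVlt => /predU1P[->|ab]; first by rewrite ltxx subrr.
by rewrite ab.
Qed.

Lemma seg_int_cst a b (k : C) : a <= b -> seg_int (fun=> k) a b = k * (b - a)%:C.
Proof.
move=> ab; apply: complex_eqP => /=; rewrite ?cReImE Rintegral_seg_cst //=; ring.
Qed.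

Lemma continuous_segM g1 g2 a b : continuous_seg g1 a b ->
  continuous_seg g2 a b -> continuous_seg (fun t => g1 t * g2 t) a b.
Proof. by move=> c1 c2 t tab; apply: cvgM; [exact: c1|exact: c2]. Qed.

Lemma continuous_seg_cst k a b : continuous_seg (fun=> k) a b.
Proof. by move=> t _; exact: cvg_cst. Qed.

Lemma seg_intD g1 g2 a b : continuous_seg g1 a b -> continuous_seg g2 a b ->
  seg_int (fun t => g1 t + g2 t) a b = seg_int g1 a b + seg_int g2 a b.
Proof.
move=> c1 c2; apply: complex_eqP => /=; rewrite ?cReImE /=.
  under eq_Rintegral do rewrite cReD.
  by rewrite RintegralD //; exact: integrable_Re.
under eq_Rintegral do rewrite cImD.
by rewrite RintegralD //; exact: integrable_Im.
Qed.

Lemma seg_intZ (k : C) g a b : continuous_seg g a b ->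
  seg_int (fun t => k * g t) a b = k * seg_int g a b.
Proof.
move=> c1; have I1 := integrable_Re c1; have I2 := integrable_Im c1.
have Z r (f : R -> R) : mu.-integrable `[a, b] (EFin \o f) ->
    mu.-integrable `[a, b] (EFin \o (fun t => r * f t)).
  move=> If; rewrite (_ : _ \o _ = fun t => (r%:E * (EFin \o f) t)%E); last first.
    by apply/funext => t /=; rewrite EFinM.
  by apply: integrableZl.
apply: complex_eqP => /=; rewrite ?cReImE /=.
  under eq_Rintegral do rewrite cReM.
  by rewrite RintegralB ?RintegralZl //; exact: Z.
under eq_Rintegral do rewrite cImM.
by rewrite RintegralD ?RintegralZl //; exact: Z.
Qed.

Lemma seg_int_split g a m b : a <= m -> m <= b -> continuous_seg g a b ->
  seg_int g a b = seg_int g a m + seg_int g m b.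
Proof.
move=> am mb gc.
have S (f : R -> R) : mu.-integrable `[a, b] (EFin \o f) ->
    \int[mu]_(t in `[a, b]) f t =
    \int[mu]_(t in `[a, m]) f t + \int[mu]_(t in `[m, b]) f t.
  move=> If; rewrite -(Rintegral_itv_obnd_cbnd (r := m)); last first.
    apply: integrableS If => //= t; rewrite /= !in_itv /= => /andP[/ltW mt ->].
    by rewrite (le_trans am mt).
  rewrite -(Rintegral_itvB (x := m) If) ?bnd_simp //; ring.
by apply: complex_eqP => /=; rewrite ?cReImE /=; apply: S;
  [exact: integrable_Re|exact: integrable_Im].
Qed.

(** The factor 2 comes from bounding real and imaginary parts separately. *)
Lemma seg_int_bound g a b (M : R) : a <= b -> continuous_seg g a b ->
  (forall t, a <= t <= b -> N (g t) <= M) -> N (seg_int g a b) <= 2 * M * (b - a).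
Proof.
move=> ab gc gM.
have B (f : R -> R) : (forall t, a <= t <= b -> {for t, continuous f}) ->
    (forall t, a <= t <= b -> `|f t| <= M) ->
    `|\int[mu]_(t in `[a, b]) f t| <= M * (b - a).
  move=> fc fM; have If := integrable_seg fc.
  apply: le_trans (le_normr_Rintegral _ If) _ => //.
  rewrite -Rintegral_seg_cst //; apply: le_Rintegral => //.
  - exact: integrable_norm If.
  - apply: integrable_seg => t _; exact: cvg_cst.
apply: le_trans (normc_leReIm _) _; rewrite /= -mulrA mulr_natl mulr2n.
apply: lerD; apply: B => t tab.
- by apply: Re_continuous; exact: gc.
- by apply: le_trans (normc_geRe _) _; exact: gM.
- by apply: Im_continuous; exact: gc.
- by apply: le_trans (normc_geIm _) _; exact: gM.
Qed.

Implicit Types (phi : C -> C) (c d : R).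

(** The integral of phi(z) dz, counterclockwise around [a, b] x [c, d]. *)
Definition rect_int phi a b c d : C :=
  seg_int (fun s => phi (s +i* c)) a b - seg_int (fun s => phi (s +i* d)) a b +
  'i * (seg_int (fun s => phi (b +i* s)) c d - seg_int (fun s => phi (a +i* s)) c d).

Definition edge a b c d (z : C) :=
  [/\ a <= Re z <= b, c <= Im z <= d &
      [\/ Re z = a, Re z = b, Im z = c | Im z = d]].

Lemma hline_continuous phi c t : {for t +i* c, continuous phi} ->
  {for t, continuous (fun s => phi (s +i* c))}.
Proof.
move=> /continuous_epsP H; apply/cvgrPdist_lt => _ /cpos_real[e e0 ->].
have [d d0 Hd] := H e e0; near=> s; rewrite normrc ltcR normcBC; apply: Hd.
rewrite normrc ltcR (_ : _ - _ = (s - t)%:C); last first.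
  by apply: complex_eqP => /=; ring.
by rewrite normc_real distrC; near: s; apply: cvgr_dist_lt => //; exact: cvg_id.
Unshelve. all: by end_near. Qed.

Lemma vline_continuous phi a t : {for a +i* t, continuous phi} ->
  {for t, continuous (fun s => phi (a +i* s))}.
Proof.
move=> /continuous_epsP H; apply/cvgrPdist_lt => _ /cpos_real[e e0 ->].
have [d d0 Hd] := H e e0; near=> s; rewrite normrc ltcR normcBC; apply: Hd.
rewrite normrc ltcR (_ : _ - _ = 'i * (s - t)%:C); last first.
  by apply: complex_eqP => /=; ring.
rewrite Normc.normcM normc_i mul1r.
by rewrite normc_real distrC; near: s; apply: cvgr_dist_lt => //; exact: cvg_id.
Unshelve. all: by end_near. Qed.

Definition continuous_edge phi a b c d :=
  forall z, edge a b c d z -> {for z, continuous phi}.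

Lemma continuous_edges phi a b c d : a <= b -> c <= d ->
  continuous_edge phi a b c d ->
  [/\ continuous_seg (fun s => phi (s +i* c)) a b,
      continuous_seg (fun s => phi (s +i* d)) a b,
      continuous_seg (fun s => phi (b +i* s)) c d &
      continuous_seg (fun s => phi (a +i* s)) c d].
Proof.
move=> ab cd H; split=> t tab.
- apply: hline_continuous; apply: H; split=> //=; first by rewrite lexx.
  exact: Or43.
- apply: hline_continuous; apply: H; split=> //=; first by rewrite lexx andbT.
  exact: Or44.
- apply: vline_continuous; apply: H; split=> //=; first by rewrite lexx andbT.
  exact: Or42.
- apply: vline_continuous; apply: H; split=> //=; first by rewrite lexx.
  exact: Or41.
Qed.

Lemma eq_rect_int phi psi a b c d : a <= b -> c <= d ->
  (forall z, edge a b c d z -> phi z = psi z) ->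
  rect_int phi a b c d = rect_int psi a b c d.
Proof.
move=> ab cd E; congr (_ - _ + _ * (_ - _)); apply: eq_seg_int => t tab; apply: E;
  split=> //=; rewrite ?lexx ?ab ?cd //.
- exact: Or43.
- exact: Or44.
- exact: Or42.
- exact: Or41.
Qed.

Lemma rect_intD phi psi a b c d : a <= b -> c <= d ->
  continuous_edge phi a b c d -> continuous_edge psi a b c d ->
  rect_int (fun z => phi z + psi z) a b c d =
  rect_int phi a b c d + rect_int psi a b c d.
Proof.
move=> ab cd /(continuous_edges ab cd)[? ? ? ?] /(continuous_edges ab cd)[? ? ? ?].
by rewrite /rect_int !seg_intD //; ring.
Qed.

Lemma rect_intZ phi k a b c d : a <= b -> c <= d -> continuous_edge phi a b c d ->
  rect_int (fun z => k * phi z) a b c d = k * rect_int phi a b c d.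
Proof.
move=> ab cd /(continuous_edges ab cd)[? ? ? ?].
by rewrite /rect_int !seg_intZ //; ring.
Qed.

Lemma rect_int_bound phi a b c d (M : R) : a <= b -> c <= d ->
  continuous_edge phi a b c d ->
  (forall z, edge a b c d z -> N (phi z) <= M) ->
  N (rect_int phi a b c d) <= 4 * M * ((b - a) + (d - c)).
Proof.
move=> ab cd /(continuous_edges ab cd)[c1 c2 c3 c4] B.
have b1 : N (seg_int (fun s => phi (s +i* c)) a b) <= 2 * M * (b - a).
  apply: seg_int_bound => // t tab; apply: B; split=> //=; rewrite ?lexx ?cd //.
  exact: Or43.
have b2 : N (seg_int (fun s => phi (s +i* d)) a b) <= 2 * M * (b - a).
  apply: seg_int_bound => // t tab; apply: B; split=> //=; rewrite ?lexx ?cd //.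
  exact: Or44.
have b3 : N (seg_int (fun s => phi (b +i* s)) c d) <= 2 * M * (d - c).
  apply: seg_int_bound => // t tab; apply: B; split=> //=; rewrite ?lexx ?ab //.
  exact: Or42.
have b4 : N (seg_int (fun s => phi (a +i* s)) c d) <= 2 * M * (d - c).
  apply: seg_int_bound => // t tab; apply: B; split=> //=; rewrite ?lexx ?ab //.
  exact: Or41.
apply: le_trans (normcD _ _) _; rewrite Normc.normcM normc_i mul1r.
by have := lerD (normcB (seg_int (fun s => phi (s +i* c)) a b)
    (seg_int (fun s => phi (s +i* d)) a b))
   (normcB (seg_int (fun s => phi (b +i* s)) c d) (seg_int (fun s => phi (a +i* s)) c d));
  lra.
Qed.

Lemma rect_int_splitx phi a m b c d : a <= m -> m <= b ->
  continuous_seg (fun s => phi (s +i* c)) a b ->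
  continuous_seg (fun s => phi (s +i* d)) a b ->
  rect_int phi a b c d = rect_int phi a m c d + rect_int phi m b c d.
Proof.
by move=> am mb c1 c2; rewrite /rect_int !(@seg_int_split _ a m b) //; ring.
Qed.

Lemma rect_int_splity phi a b c m d : c <= m -> m <= d ->
  continuous_seg (fun s => phi (a +i* s)) c d ->
  continuous_seg (fun s => phi (b +i* s)) c d ->
  rect_int phi a b c d = rect_int phi a b c m + rect_int phi a b m d.
Proof.
by move=> cm md c1 c2; rewrite /rect_int !(@seg_int_split _ c m d) //; ring.
Qed.

(** On opposite edges the identity function differs by a constant, so pairing the
    edges leaves integrals of constants. *)
Lemma rect_int_affine (al be : C) a b c d : a <= b -> c <= d ->
  rect_int (fun z => al + be * z) a b c d = 0.
Proof.
move=> ab cd.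
have ce (f : C -> C) : continuous f -> continuous_edge f a b c d.
  by move=> fc z _; exact: fc.
have cid : continuous_edge id a b c d by apply: ce => z; exact: cvg_id.
have ccst k : continuous_edge (fun=> k) a b c d by apply: ce => z; exact: cst_continuous.
have cm : continuous_edge (fun z => be * z) a b c d.
  by apply: ce; exact: mulrl_continuous.
rewrite (rect_intD ab cd (ccst al) cm) (rect_intZ be ab cd cid).
have -> : rect_int (fun=> al) a b c d = 0 by rewrite /rect_int !seg_int_cst //; ring.
have -> : rect_int id a b c d = 0; last by rewrite mulr0 addr0.
have [c1 c2 c3 c4] := continuous_edges ab cd cid.
have D g1 g2 x y : continuous_seg g1 x y -> continuous_seg g2 x y ->
    seg_int g1 x y - seg_int g2 x y = seg_int (fun t => g1 t + (-1) * g2 t) x y.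
  move=> k1 k2.
  have k3 : continuous_seg (fun t => -1 * g2 t) x y.
    by apply: continuous_segM; [exact: continuous_seg_cst|exact: k2].
  by rewrite (seg_intD k1 k3) (seg_intZ (-1) k2) mulN1r.
rewrite /rect_int (D _ _ _ _ c1 c2) (D _ _ _ _ c3 c4).
rewrite (@eq_seg_int _ (fun=> 'i * (c - d)%:C) a b); last first.
  by move=> t _; apply: complex_eqP => /=; ring.
rewrite (@eq_seg_int _ (fun=> (b - a)%:C) c d); last first.
  by move=> t _; apply: complex_eqP => /=; ring.
by rewrite !seg_int_cst //; apply: complex_eqP => /=; ring.
Qed.

End Integral.

(** * Goursat's theorem *)

Section Goursat.
Variable R : realType.
Local Notation C := R[i].
Local Notation N := (@Normc.normc R).
Implicit Types (phi : C -> C) (a b c d : R).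

Lemma differentiable_continuous_at phi z : differentiable phi z ->
  {for z, continuous phi}.
Proof. exact: differentiable_continuous. Qed.

(** The supremum of the left ends lies in every interval. *)
Lemma nested_intervals (x : nat -> R) (l : nat -> R) :
  (forall n, x n <= x n.+1) -> (forall n, 0 <= l n) ->
  (forall n, x n.+1 + l n.+1 <= x n + l n) ->
  exists X, forall n, x n <= X <= x n + l n.
Proof.
move=> xi l0 xd.
have xm m n : (m <= n)%N -> x m <= x n.
  move=> /subnKC <-; elim: (n - m)%N => [|k IH]; first by rewrite addn0.
  by rewrite addnS; apply: le_trans IH _.
have xM m n : (m <= n)%N -> x n + l n <= x m + l m.
  move=> /subnKC <-; elim: (n - m)%N => [|k IH]; first by rewrite addn0.
  by rewrite addnS; apply: le_trans IH.
have xb m n : x m <= x n + l n.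
  have [mn|/ltnW nm] := leqP m n.
    by apply: le_trans (xm _ _ mn) _; rewrite lerDl.
  by apply: le_trans (xM _ _ nm); rewrite lerDl.
have hs : has_sup [set x n | n in [set: nat]].
  split; first by exists (x 0%N), 0%N.
  by exists (x 0%N + l 0%N) => _ [n _ <-].
exists (sup [set x n | n in [set: nat]]) => n; apply/andP; split.
  by apply: sup_upper_bound => //; exists n.
by apply: sup_le_ub => [|_ [m _ <-]//]; exact: hs.1.
Qed.

Lemma half_pow_small (e : R) : 0 < e -> exists n, 2^-1 ^+ n < e.
Proof.
move=> e0; exists (Num.bound e^-1).
have := archi_boundP (ltW (x := 0) (y := e^-1) _); rewrite invr_gt0 => /(_ e0) H.
rewrite exprVn invf_plt ?posrE ?exprn_gt0 //; apply: lt_trans H _.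
by rewrite -natrX ltr_nat ltn_expl.
Qed.

Section Step.
Variables (phi : C -> C) (a b c d : R).
Hypothesis phid : forall z, a <= Re z <= b -> c <= Im z <= d -> differentiable phi z.

Lemma continuous_edge_sub a' b' c' d' : a <= a' -> b' <= b -> c <= c' -> d' <= d ->
  continuous_edge phi a' b' c' d'.
Proof.
move=> aa bb cc dd z [/andP[z1 z2] /andP[z3 z4] _].
apply: differentiable_continuous_at; apply: phid.
  by rewrite (le_trans aa z1) (le_trans z2 bb).
by rewrite (le_trans cc z3) (le_trans z4 dd).
Qed.

(** The integral over a rectangle is the sum of those over its four quarters,
    so one of them carries at least a quarter of the modulus. *)
Lemma rect_int_quarter x y w h (M : R) : a <= x -> 0 <= w -> x + w + w <= b ->
  c <= y -> 0 <= h -> y + h + h <= d ->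
  4 * M <= N (rect_int phi x (x + w + w) y (y + h + h)) ->
  exists x' y', [/\ x' = x \/ x' = x + w, y' = y \/ y' = y + h &
    M <= N (rect_int phi x' (x' + w) y' (y' + h))].
Proof.
move=> ax w0 wb cy h0 hd.
have ww : x + w <= x + w + w by rewrite lerDl.
have hh : y + h <= y + h + h by rewrite lerDl.
have xw : x <= x + w by rewrite lerDl.
have yh : y <= y + h by rewrite lerDl.
have [c1 c2 _ _] := continuous_edges (le_trans xw ww) (le_trans yh hh)
  (continuous_edge_sub ax wb cy hd).
rewrite (@rect_int_splitx _ _ _ (x + w)) //.
have [_ _ c3 c4] := continuous_edges xw (le_trans yh hh)
  (continuous_edge_sub ax (le_trans ww wb) cy hd).
have [_ _ c5 c6] := continuous_edges ww (le_trans yh hh)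
  (continuous_edge_sub (le_trans ax xw) wb cy hd).
rewrite (@rect_int_splity _ _ _ _ _ (y + h)) //.
rewrite (@rect_int_splity _ _ (x + w) _ _ (y + h)) //.
set A := rect_int phi x (x + w) y (y + h).
set B := rect_int phi x (x + w) (y + h) _.
set D := rect_int phi (x + w) _ y (y + h).
set E := rect_int phi (x + w) _ (y + h) _ => H.
have : 4 * M <= N A + N B + (N D + N E).
  apply: le_trans H _; apply: le_trans (normcD _ _) _.
  by apply: lerD; exact: normcD.
have [HA _|HA] := leP M (N A); first by exists x, y; split=> //; left.
have [HB _|HB] := leP M (N B); first by exists x, (y + h); split=> //; [left|right].
have [HD _|HD] := leP M (N D); first by exists (x + w), y; split=> //; [right|left].
have [HE _|HE] := leP M (N E); first by exists (x + w), (y + h); split=> //; right.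
move=> H4; have := le_lt_trans H4 (ltrD (ltrD HA HB) (ltrD HD HE)).
by rewrite (_ : M + M + (M + M) = 4 * M) ?ltxx //; ring.
Qed.

End Step.

(** Near a point of differentiability the function is affine up to a small
    multiple of the distance, and affine functions have integral 0; the remainder
    is integrated over a boundary of length O(l) on which it is o(l).  Here l is
    the scale of the rectangle and K bounds its half perimeter at scale 1. *)
Lemma rect_int_local phi (p : C) (e K : R) : 0 < e -> 0 <= K -> differentiable phi p ->
  exists2 del : R, 0 < del & forall x y w h l, 0 <= w -> 0 <= h -> w + h <= K * l ->
    0 < l -> K * l < del ->
    x <= Re p <= x + w -> y <= Im p <= y + h ->
    continuous_edge phi x (x + w) y (y + h) ->
    N (rect_int phi x (x + w) y (y + h)) < e * l ^+ 2.
Proof.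
move=> e0 K0 dp; pose eta := e / (8 * (K ^+ 2 + 1)).
have K1 : 0 < K ^+ 2 + 1 by rewrite ltr_wpDl ?sqr_ge0.
have eta0 : 0 < eta by rewrite divr_gt0 // mulr_gt0.
have [del del0 H] := derive1_eps dp eta0; exists del => // x y w h l.
move=> w0 h0 whK l0 Kdel /andP[px px'] /andP[py py'] cphi.
set D := derive1 phi p in H.
pose r z := phi z + (- (phi p - D * p) + - D * z).
have xw : x <= x + w by rewrite lerDl.
have yh : y <= y + h by rewrite lerDl.
have caff (al be : C) : continuous_edge (fun z => al + be * z) x (x + w) y (y + h).
  move=> z _; apply: (@continuousD C C C (cst al) ( *%R be)); first exact: cst_continuous.
  exact: mulrl_continuous.
have cr : continuous_edge r x (x + w) y (y + h).
  move=> z Ez; apply: (@continuousD C C C phi (fun z => - (phi p - D * p) + - D * z)).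
    exact: cphi.
  exact: caff.
have -> : rect_int phi x (x + w) y (y + h) = rect_int r x (x + w) y (y + h).
  by rewrite (rect_intD xw yh cphi (caff _ _)) (rect_int_affine _ _ xw yh) addr0.
have rB z : edge x (x + w) y (y + h) z -> N (r z) <= eta * (K * l).
  move=> [/andP[z1 z2] /andP[z3 z4] _].
  have zp : N (z - p) <= K * l.
    apply: le_trans (normc_leReIm _) _; rewrite !cReImE; apply: (le_trans _ whK).
    by apply: lerD; rewrite ler_norml; apply/andP; split; lra.
  have := H (z - p) (le_lt_trans zp Kdel).
  rewrite [p + _]addrC subrK (_ : _ - _ - _ = r z); last by rewrite /r; ring.
  by move=> /le_trans; apply; rewrite ler_wpM2l // ltW.
have := rect_int_bound xw yh cr rB.
rewrite (_ : _ + (y + h - y) = w + h); last by ring.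
move=> /le_lt_trans; apply.
apply: (@le_lt_trans _ _ (4 * (eta * (K * l)) * (K * l))).
  apply: (ler_wpM2l _ whK).
  by have := mulr_ge0 (ltW eta0) (mulr_ge0 K0 (ltW l0)); lra.
have -> : 4 * (eta * (K * l)) * (K * l) = 4 * eta * K ^+ 2 * l ^+ 2 by ring.
rewrite ltr_pM2r ?exprn_gt0 //.
have -> : e = 8 * eta * (K ^+ 2 + 1) by rewrite /eta; field; rewrite gt_eqF.
have := sqr_ge0 K; nra.
Qed.

(** If the integral were nonzero, bisection would give nested rectangles of scale
    2^-n whose integrals are at least 4^-n times the original one; at their common
    point this contradicts [rect_int_local]. *)
Theorem goursat phi a b c d : a <= b -> c <= d ->
  (forall z, a <= Re z <= b -> c <= Im z <= d -> differentiable phi z) ->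
  rect_int phi a b c d = 0.
Proof.
move=> ab cd phid; apply/eqP; rewrite -normc_eq0; apply/eqP/le_anti.
rewrite normc_ge0 andbT leNgt; apply/negP; set e := N _ => e0.
set lam := b - a; set m := d - c.
have lam0 : 0 <= lam by rewrite subr_ge0.
have m0 : 0 <= m by rewrite subr_ge0.
pose l n : R := 2^-1 ^+ n.
have l0 n : 0 < l n by rewrite exprn_gt0 // invr_gt0.
have lS n : l n = l n.+1 + l n.+1 by rewrite /l exprS; field.
pose P n (s : R * R) := [/\ a <= s.1 /\ s.1 + lam * l n <= b,
  c <= s.2 /\ s.2 + m * l n <= d &
  e * l n ^+ 2 <= N (rect_int phi s.1 (s.1 + lam * l n) s.2 (s.2 + m * l n))].
(* F chooses the next quarter; its specification is conditional on P, which holds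
   all along the sequence s. *)
have [F HF] : {F : nat * (R * R) -> R * R & forall ns, P ns.1 ns.2 ->
    [/\ P ns.1.+1 (F ns), ns.2.1 <= (F ns).1, ns.2.2 <= (F ns).2,
      (F ns).1 + lam * l ns.1.+1 <= ns.2.1 + lam * l ns.1 &
      (F ns).2 + m * l ns.1.+1 <= ns.2.2 + m * l ns.1]}.
  apply: (choice (P := fun (ns : nat * (R * R)) s' => P ns.1 ns.2 ->
    [/\ P ns.1.+1 s', ns.2.1 <= s'.1, ns.2.2 <= s'.2,
      s'.1 + lam * l ns.1.+1 <= ns.2.1 + lam * l ns.1 &
      s'.2 + m * l ns.1.+1 <= ns.2.2 + m * l ns.1])) => -[n [x y]] /=.
  have [[/= [ax xb] [cy yd]]|nP] := EM (P n (x, y)); last by exists (x, y).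
  have lw : 0 <= lam * l n.+1 by rewrite mulr_ge0 // ltW.
  have lh : 0 <= m * l n.+1 by rewrite mulr_ge0 // ltW.
  have eqx : x + lam * l n = x + lam * l n.+1 + lam * l n.+1 by rewrite lS; ring.
  have eqy : y + m * l n = y + m * l n.+1 + m * l n.+1 by rewrite lS; ring.
  have -> : e * l n ^+ 2 = 4 * (e * l n.+1 ^+ 2) by rewrite lS; ring.
  move: xb yd; rewrite eqx eqy => xb yd big.
  have [x' [y' [hx hy H]]] := rect_int_quarter phid ax lw xb cy lh yd big.
  have x1 : x <= x' by case: hx => -> //; rewrite lerDl.
  have x2 : x' + lam * l n.+1 <= x + lam * l n.+1 + lam * l n.+1.
    by case: hx => -> //; rewrite lerDl.
  have y1 : y <= y' by case: hy => -> //; rewrite lerDl.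
  have y2 : y' + m * l n.+1 <= y + m * l n.+1 + m * l n.+1.
    by case: hy => -> //; rewrite lerDl.
  exists (x', y') => _; rewrite /=; split=> //; split=> //=.
  - by rewrite (le_trans ax x1) (le_trans x2 xb).
  - by rewrite (le_trans cy y1) (le_trans y2 yd).
pose s := fix s n := if n is n'.+1 then F (n', s n') else (a, c).
have Ps n : P n (s n).
  elim: n => [|n IH]; last by have [] := HF (n, s n) IH.
  rewrite /P /l /= expr0 !mulr1 expr1n mulr1.
  rewrite (_ : a + lam = b) 1?(_ : c + m = d) ?/lam ?/m ?subrKC //.
have sS n := HF (n, s n) (Ps n).
have [X HX] : exists X, forall n, (s n).1 <= X <= (s n).1 + lam * l n.
  apply: nested_intervals => n; last by have [] := sS n.
    by have [] := sS n.
  by rewrite mulr_ge0 // ltW.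
have [Y HY] : exists Y, forall n, (s n).2 <= Y <= (s n).2 + m * l n.
  apply: nested_intervals => n; last by have [] := sS n.
    by have [] := sS n.
  by rewrite mulr_ge0 // ltW.
have dXY : differentiable phi (X +i* Y).
  apply: phid => /=.
    have := HX 0%N; rewrite /l expr0 mulr1 /= /lam; lra.
  have := HY 0%N; rewrite /l expr0 mulr1 /= /m; lra.
have [del del0 Hd] := rect_int_local e0 (addr_ge0 lam0 m0) dXY.
have lm0 : 0 < lam + m + 1 by lra.
have [n Hn] : exists n, l n < del / (lam + m + 1).
  by apply: half_pow_small; rewrite divr_gt0.
have [[h1 h2] [h3 h4]] := Ps n; apply/negP; rewrite -ltNge; apply: (Hd _ _ _ _ (l n)) => //.
- by rewrite mulr_ge0 // ltW.
- by rewrite mulr_ge0 // ltW.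
- by lra.
- move: Hn; rewrite ltr_pdivlMr //.
  by have := l0 n; nra.
- exact: (continuous_edge_sub phid h1 h2 h3 h4).
Qed.

End Goursat.

(** * The Cauchy formula on squares *)

Section Cauchy.
Variable R : realType.
Local Notation C := R[i].
Local Notation N := (@Normc.normc R).
Implicit Types (F h phi : C -> C) (a b c d r rho : R) (z t : C).

Definition entire h := forall z, differentiable h z.

(** A function differentiable away from t has the same integral over any rectangle
    around t as over a small square centred at t: the rest is cut into the columns on
    the left and on the right and the pieces below and above the square. *)
Lemma rect_int_annulus F t a b c d r : 0 < r ->
  a <= Re t - r -> Re t + r <= b -> c <= Im t - r -> Im t + r <= d ->
  (forall z, z != t -> differentiable F z) ->
  rect_int F a b c d = rect_int F (Re t - r) (Re t + r) (Im t - r) (Im t + r).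
Proof.
move=> r0 ar rb cr rd dF.
have far z : Re z < Re t \/ Re t < Re z \/ Im z < Im t \/ Im t < Im z -> z != t.
  move=> H; apply/eqP => E; move: H; rewrite E; lra.
have hc y x1 x2 : y < Im t \/ Im t < y -> continuous_seg (fun s => F (s +i* y)) x1 x2.
  move=> H s _; apply: hline_continuous; apply: differentiable_continuous_at.
  by apply: dF; apply: far => /=; tauto.
have vc x y1 y2 : x < Re t \/ Re t < x -> continuous_seg (fun s => F (x +i* s)) y1 y2.
  move=> H s _; apply: vline_continuous; apply: differentiable_continuous_at.
  by apply: dF; apply: far => /=; tauto.
rewrite (@rect_int_splitx _ _ _ (Re t - r)) //; [|lra|by apply: hc; left; lra|
  by apply: hc; right; lra].
rewrite goursat; [|lra|lra|by move=> z z1 z2; apply: dF; apply: far; lra].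
rewrite (@rect_int_splitx _ _ _ (Re t + r)) //; [|lra|by apply: hc; left; lra|
  by apply: hc; right; lra].
rewrite [X in _ + (_ + X)]goursat; [|lra|lra|
  by move=> z z1 z2; apply: dF; apply: far; right; left; lra].
rewrite (@rect_int_splity _ _ _ _ _ (Im t - r)) //; [|lra|by apply: vc; left; lra|
  by apply: vc; right; lra].
rewrite goursat; [|lra|lra|
  by move=> z z1 z2; apply: dF; apply: far; right; right; left; lra].
rewrite (@rect_int_splity _ _ _ _ _ (Im t + r)) //; [|lra|by apply: vc; left; lra|
  by apply: vc; right; lra].
rewrite [X in _ + (_ + (_ + X) + _)]goursat; [|lra|lra|
  by move=> z z1 z2; apply: dF; apply: far; right; right; right; lra].
by rewrite !(add0r, addr0).
Qed.

Lemma differentiable_subV t z : z != t ->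
  differentiable (fun z : C => (z - t)^-1) z.
Proof.
move=> zt; apply: differentiableV; last by rewrite subr_eq0.
by apply: differentiableB; [exact: ex_diff|exact: differentiable_cst].
Qed.

(** The form in which limits at infinity are taken: x = O(1/s) forces x <= 0. *)
Lemma le0_archi (x A rho : R) : (forall s, rho <= s -> x * s <= A) -> x <= 0.
Proof.
move=> H; rewrite leNgt; apply/negP => x0.
have := H (Num.max rho ((A + 1) / x)); rewrite le_max lexx => /(_ isT).
apply/negP; rewrite -ltNge.
apply: (@lt_le_trans _ _ (A + 1)); first by rewrite ltrDl.
by rewrite -ler_pdivrMl // mulrC le_max lexx orbT.
Qed.

(** The difference quotient is bounded near t, and its integral is the same over
    arbitrarily small squares around t, hence at most O(r) for each r. *)
Lemma cauchy_quotient h t a b c d : entire h ->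
  a < Re t -> Re t < b -> c < Im t -> Im t < d ->
  rect_int (fun z => (h z - h t) / (z - t)) a b c d = 0.
Proof.
move=> dh at' tb ct td; set F := fun z => _.
have dF z : z != t -> differentiable F z.
  move=> zt; apply: differentiableM; last exact: differentiable_subV.
  by apply: differentiableB; [exact: dh|exact: differentiable_cst].
have [del del0 Hd] := derive1_eps (dh t) (@ltr01 R).
set D := derive1 h t in Hd.
pose r0 := Num.min (Num.min (Re t - a) (b - Re t)) (Num.min (Im t - c) (d - Im t)).
have r0p : 0 < r0 by rewrite !lt_min !subr_gt0 at' tb ct.
pose r1 := Num.min r0 (del / 4).
have r1p : 0 < r1 by rewrite lt_min r0p divr_gt0.
apply/eqP; rewrite -normc_eq0; apply/eqP/le_anti; rewrite normc_ge0 andbT.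
apply: (@le0_archi _ (16 * (N D + 1)) r1^-1) => s rs.
have s0 : 0 < s by apply: lt_le_trans rs; rewrite invr_gt0.
have r0' : 0 < s^-1 by rewrite invr_gt0.
have : s^-1 <= r1 by rewrite invf_ple ?posrE.
rewrite /r1 /r0 !le_min => /andP[/andP[/andP[h1 h2] /andP[h3 h4]] h5].
rewrite (@rect_int_annulus F t _ _ _ _ s^-1) //; [|lra|lra|lra|lra].
have ab : Re t - s^-1 <= Re t + s^-1 by lra.
have cd : Im t - s^-1 <= Im t + s^-1 by lra.
have zt z : edge (Re t - s^-1) (Re t + s^-1) (Im t - s^-1) (Im t + s^-1) z ->
    z != t /\ N (z - t) < del.
  move=> [/andP[z1 z2] /andP[z3 z4] z5]; split.
    apply/eqP => E; move: z5; rewrite E => -[]; lra.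
  apply: le_lt_trans (normc_leReIm _) _; rewrite !cReImE.
  apply: (@le_lt_trans _ _ (s^-1 + s^-1)); last by lra.
  by apply: lerD; rewrite ler_norml; apply/andP; split; lra.
have cF : continuous_edge F (Re t - s^-1) (Re t + s^-1) (Im t - s^-1) (Im t + s^-1).
  by move=> z /zt[z0 _]; apply: differentiable_continuous_at; exact: dF.
have := rect_int_bound ab cd cF (M := N D + 1).
move=> H; rewrite -ler_pdivlMr // mulrC.
apply: le_trans (H _) _; last by lra.
move=> z /zt[z0 zd]; rewrite /F Normc.normcM Normc.normcV.
have zt0 : 0 < N (z - t) by rewrite normc_gt0 subr_eq0.
rewrite ler_pdivrMr //.
have := Hd (z - t) zd; rewrite [t + _]addrC subrK mul1r.
have := normcD (h z - h t - D * (z - t)) (D * (z - t)).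
by rewrite subrK Normc.normcM; lra.
Qed.

Definition square rho phi := rect_int phi (- rho) rho (- rho) rho.
Definition square_edge rho z := edge (- rho) rho (- rho) rho z.
(** This is 2 i pi times the winding number of the square around t; as t runs over
    the inside it stays constant ([wind_const]) and nonzero ([wind_ge4]). *)
Definition wind rho t := square rho (fun z => (z - t)^-1).

Lemma square_edge_norm rho z : 0 < rho -> square_edge rho z ->
  rho <= N z <= 2 * rho.
Proof.
move=> r0 [/andP[z1 z2] /andP[z3 z4] z5]; apply/andP; split.
  have := normc_geRe z; have := normc_geIm z; rewrite !ler_norml.
  by move=> /andP[? ?] /andP[? ?]; case: z5; lra.
apply: le_trans (normc_leReIm _) _; rewrite mulr_natl mulr2n.
by apply: lerD; rewrite ler_norml; apply/andP; split; lra.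
Qed.

Lemma square_edge_sub rho z t : 0 < rho -> N t <= rho / 2 -> square_edge rho z ->
  rho / 2 <= N (z - t).
Proof.
move=> r0 tr /square_edge_norm => /(_ r0) /andP[zr _].
by have := normcB_ge z t; lra.
Qed.

Lemma square_edge_neq rho z t : 0 < rho -> N t <= rho / 2 -> square_edge rho z ->
  z != t.
Proof.
move=> r0 tr /square_edge_sub => /(_ _ r0 tr); rewrite -subr_eq0 -normc_gt0.
by apply: lt_le_trans; rewrite divr_gt0.
Qed.

Lemma inside_square rho t : 0 < rho -> N t <= rho / 2 ->
  (- (rho / 2) <= Re t <= rho / 2) /\ (- (rho / 2) <= Im t <= rho / 2).
Proof.
move=> r0 tr; rewrite -!ler_norml.
by split; [apply: le_trans (normc_geRe _) tr|apply: le_trans (normc_geIm _) tr].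
Qed.

Definition square_continuous rho phi :=
  continuous_edge phi (- rho) rho (- rho) rho.

Lemma square_continuousM rho phi psi : square_continuous rho phi ->
  square_continuous rho psi -> square_continuous rho (fun z => phi z * psi z).
Proof.
move=> c1 c2 z Ez; apply: (@continuousM C C phi psi); [exact: c1|exact: c2].
Qed.

Lemma square_continuous_entire rho h : entire h -> square_continuous rho h.
Proof. by move=> dh z _; exact: differentiable_continuous_at. Qed.

Lemma square_continuous_cst rho (k : C) : square_continuous rho (fun=> k).
Proof. by move=> z _; exact: cst_continuous. Qed.

Lemma square_continuous_subV rho t : 0 < rho -> N t <= rho / 2 ->
  square_continuous rho (fun z => (z - t)^-1).
Proof.
move=> r0 tr z Ez; apply: differentiable_continuous_at.
by apply: differentiable_subV; exact: square_edge_neq Ez.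
Qed.

Lemma cauchy_formula h rho t : entire h -> 0 < rho -> N t <= rho / 2 ->
  square rho (fun z => h z * (z - t)^-1) = h t * wind rho t.
Proof.
move=> dh r0 tr; have rr : - rho <= rho by lra.
have [/andP[t1 t2] /andP[t3 t4]] := inside_square r0 tr.
have Q : square rho (fun z => (h z - h t) / (z - t)) = 0.
  by apply: cauchy_quotient => //; lra.
have cV := square_continuous_subV r0 tr.
have dq : square_continuous rho (fun z => (h z - h t) / (z - t)).
  apply: square_continuousM cV; apply: square_continuous_entire => z.
  by apply: differentiableB; [exact: dh|exact: differentiable_cst].
have ck := square_continuousM (@square_continuous_cst rho (h t)) cV.
rewrite /square (@eq_rect_int _ _ (fun z => (h z - h t) / (z - t) + h t * (z - t)^-1)) //.
  by rewrite (rect_intD rr rr dq ck) (rect_intZ _ rr rr cV) -/(square rho _) Q add0r.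
by move=> z _; ring.
Qed.

Lemma square_bound rho phi (M : R) : 0 < rho -> square_continuous rho phi ->
  (forall z, square_edge rho z -> N (phi z) <= M) ->
  N (square rho phi) <= 16 * M * rho.
Proof.
move=> r0 cphi B; have rr : - rho <= rho by lra.
by apply: le_trans (rect_int_bound rr rr cphi B) _; lra.
Qed.

Lemma wind_resize rho1 rho2 t : 0 < rho1 -> rho1 <= rho2 -> N t <= rho1 / 2 ->
  wind rho1 t = wind rho2 t.
Proof.
move=> r0 r12 tr; have [/andP[t1 t2] /andP[t3 t4]] := inside_square r0 tr.
have dF z : z != t -> differentiable (fun z : C => (z - t)^-1) z.
  exact: differentiable_subV.
rewrite /wind /square (@rect_int_annulus _ t _ _ _ _ (rho1 / 2)) //; [|lra|lra|lra|lra|lra].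
by apply/esym; apply: rect_int_annulus => //; lra.
Qed.

(** On the square of radius s the kernels at t and at 0 differ by O(1/s^2), and
    enlarging the square does not change either integral. *)
Lemma wind_const rho t : 0 < rho -> N t <= rho / 2 -> wind rho t = wind 1 0.
Proof.
move=> r0 tr; have z0 s : 0 < s -> N 0 <= s / 2.
  by move=> s0; rewrite Normc.normc0 divr_ge0 // ltW.
transitivity (wind rho 0); last first.
  have [r1|/ltW r1] := leP rho 1; first by apply: wind_resize => //; exact: z0.
  by apply/esym; apply: wind_resize => //; exact: z0.
apply/eqP; rewrite -subr_eq0 -normc_eq0; apply/eqP/le_anti.
rewrite normc_ge0 andbT; apply: (@le0_archi _ (32 * N t) rho) => s rs.
have s0 : 0 < s by exact: lt_le_trans rs.
have ss : - s <= s by lra.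
have ts : N t <= s / 2 by lra.
rewrite (wind_resize r0 rs tr) (wind_resize r0 rs (z0 _ r0)).
have c1 := square_continuous_subV s0 ts.
have c2 := square_continuous_subV s0 (z0 _ s0).
have c12 := square_continuousM (@square_continuous_cst s t) (square_continuousM c1 c2).
have -> : wind s t = square s (fun z => t * ((z - t)^-1 * (z - 0)^-1)) + wind s 0.
  rewrite /wind /square -(rect_intD ss ss c12 c2); apply: eq_rect_int => // z Ez.
  have := square_edge_neq s0 ts Ez; have := square_edge_neq s0 (z0 _ s0) Ez.
  rewrite subr0 => zn0 znt; have zt0 : z - t != 0 by rewrite subr_eq0.
  by field; apply/andP.
rewrite addrK -ler_pdivlMr //.
have -> : 32 * N t / s = 16 * (N t * ((2 / s) * s^-1)) * s.
  by field; rewrite gt_eqF.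
apply: square_bound => // z Ez; rewrite !Normc.normcM !Normc.normcV.
apply: ler_wpM2l; first exact: normc_ge0.
have e1 := square_edge_sub s0 ts Ez.
have e2 : s <= N (z - 0) by rewrite subr0; have /andP[] := square_edge_norm s0 Ez.
have p2 : 0 < N (z - 0) by apply: lt_le_trans e2.
have p1 : 0 < N (z - t) by apply: lt_le_trans e1; rewrite divr_gt0.
apply: ler_pM; rewrite ?invr_ge0 ?normc_ge0 //.
  by rewrite -invf_div lef_pV2 ?posrE ?divr_gt0.
by rewrite lef_pV2 ?posrE.
Qed.

Lemma Rintegral_seg_ge (f : R -> R) a b (k : R) : a <= b ->
  (forall t : R, a <= t <= b -> {for t, continuous f}) ->
  (forall t : R, a <= t <= b -> k <= f t) ->
  k * (b - a) <= \int[@lebesgue_measure R]_(t in `[a, b]) f t.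
Proof.
move=> ab fc fk; rewrite -Rintegral_seg_cst //; apply: le_Rintegral => //.
- by apply: integrable_seg => t _; exact: cst_continuous.
- exact: integrable_seg.
Qed.

Lemma Rintegral_seg_le (f : R -> R) a b (k : R) : a <= b ->
  (forall t : R, a <= t <= b -> {for t, continuous f}) ->
  (forall t : R, a <= t <= b -> f t <= k) ->
  \int[@lebesgue_measure R]_(t in `[a, b]) f t <= k * (b - a).
Proof.
move=> ab fc fk; rewrite -Rintegral_seg_cst //; apply: le_Rintegral => //.
- exact: integrable_seg.
- by apply: integrable_seg => t _; exact: cst_continuous.
Qed.

Lemma Re_seg_int (g : R -> C) a b :
  Re (seg_int g a b) = \int[@lebesgue_measure R]_(t in `[a, b]) Re (g t).
Proof. by []. Qed.

Lemma Im_seg_int (g : R -> C) a b :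
  Im (seg_int g a b) = \int[@lebesgue_measure R]_(t in `[a, b]) Im (g t).
Proof. by []. Qed.

Lemma invcE (x y : R) : (x +i* y)^-1 = (x / (x ^+ 2 + y ^+ 2)) +i* (- (y / (x ^+ 2 + y ^+ 2))).
Proof. by []. Qed.

(** Each edge contributes the integral of 1/(1 + s^2) over [-1, 1] to the imaginary
    part, which is at least 1. *)
Lemma wind_ge4 : 4 <= N (wind 1 0).
Proof.
apply: le_trans (normc_geIm _); apply: le_trans (ler_norm _).
have cV : square_continuous 1 (fun z => (z - 0)^-1).
  by apply: square_continuous_subV => //; rewrite Normc.normc0 divr_ge0.
have rr : - 1 <= 1 :> R by lra.
have [c1 c2 c3 c4] := continuous_edges rr rr cV.
have half s : -1 <= s <= 1 -> 2^-1 <= (s ^+ 2 + 1)^-1 :> R.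
  move=> /andP[s1 s2]; have := sqr_ge0 s => s0.
  by rewrite lef_pV2 ?posrE //; nra.
have h1 : 2^-1 * (1 - -1) <= Im (seg_int (fun s : R => (s +i* -1 - 0)^-1) (-1) 1).
  rewrite Im_seg_int.
  apply: (@Rintegral_seg_ge (fun s : R => Im ((s +i* -1 - 0)^-1)) _ _ 2^-1 rr) => t tI.
    by apply: Im_continuous; exact: c1.
  by rewrite subr0 invcE /= sqrrN expr1n mulN1r opprK; exact: half.
have h2 : Im (seg_int (fun s : R => (s +i* 1 - 0)^-1) (-1) 1) <= - 2^-1 * (1 - -1).
  rewrite Im_seg_int.
  apply: (@Rintegral_seg_le (fun s : R => Im ((s +i* 1 - 0)^-1)) _ _ (- 2^-1) rr) => t tI.
    by apply: Im_continuous; exact: c2.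
  by rewrite subr0 invcE /= expr1n mul1r lerN2; exact: half.
have h3 : 2^-1 * (1 - -1) <= Re (seg_int (fun s : R => (1 +i* s - 0)^-1) (-1) 1).
  rewrite Re_seg_int.
  apply: (@Rintegral_seg_ge (fun s : R => Re ((1 +i* s - 0)^-1)) _ _ 2^-1 rr) => t tI.
    by apply: Re_continuous; exact: c3.
  by rewrite subr0 invcE /= expr1n mul1r addrC; exact: half.
have h4 : Re (seg_int (fun s : R => (-1 +i* s - 0)^-1) (-1) 1) <= - 2^-1 * (1 - -1).
  rewrite Re_seg_int.
  apply: (@Rintegral_seg_le (fun s : R => Re ((-1 +i* s - 0)^-1)) _ _ (- 2^-1) rr) => t tI.
    by apply: Re_continuous; exact: c4.
  by rewrite subr0 invcE /= sqrrN expr1n mulN1r lerN2 addrC; exact: half.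
rewrite /wind /square /rect_int !cReImE (_ : Re 'i = 0) // (_ : Im 'i = 1) // mul0r add0r mul1r; lra.
Qed.

End Cauchy.

(** * Taylor estimates and removable singularities *)

Section OneVariable.
Variable R : realType.
Local Notation C := R[i].
Local Notation N := (@Normc.normc R).
Implicit Types (h phi : C -> C) (rho M : R) (z t : C).

(** Taylor estimates are stated with a bound on the annulus that contains the
    boundary of the square of radius rho.  It is local when rho is small and
    it ignores the centre when rho is large. *)
Definition annulus_bound h rho M := forall z, rho <= N z <= 2 * rho -> N (h z) <= M.

Lemma annulus_bound_ge0 h rho M : 0 < rho -> annulus_bound h rho M -> 0 <= M.
Proof.
move=> r0 B; apply: le_trans (normc_ge0 (h rho%:C)) _; apply: B.
by rewrite normc_real (gtr0_norm r0); lra.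
Qed.

Lemma wind_neq0 : wind 1 0 != 0 :> C.
Proof. by rewrite -normc_gt0; apply: lt_le_trans (wind_ge4 R). Qed.

Lemma le_div_wind (w : C) (B : R) : 0 <= B -> N w <= 4 * B -> N (w / wind 1 0) <= B.
Proof.
move=> B0 wB; have W := wind_ge4 R; rewrite Normc.normcM Normc.normcV.
by rewrite ler_pdivrMr; [nra|exact: lt_le_trans W].
Qed.

Section Estimates.
Variables (h : C -> C) (rho M : R).
Hypotheses (dh : entire h) (rho0 : 0 < rho) (B : annulus_bound h rho M).

Let N0 : N 0 <= rho / 2.
Proof. by rewrite Normc.normc0 divr_ge0 // ltW. Qed.

Let u z : C := (z - 0)^-1.

Let cu : square_continuous rho u.
Proof. exact: square_continuous_subV. Qed.

Let ch : square_continuous rho h.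
Proof. exact: square_continuous_entire. Qed.

Let hM z : square_edge rho z -> N (h z) <= M.
Proof. by move=> /(square_edge_norm rho0); exact: B. Qed.

Let uM z : square_edge rho z -> N (u z) <= rho^-1.
Proof.
move=> Ez; have /andP[rz _] := square_edge_norm rho0 Ez.
by rewrite /u subr0 Normc.normcV lef_pV2 ?posrE // (lt_le_trans rho0).
Qed.

Let vM t z : N t <= rho / 2 -> square_edge rho z -> N ((z - t)^-1) <= 2 / rho.
Proof.
move=> tr Ez; have e1 := square_edge_sub rho0 tr Ez.
have r2 : 0 < rho / 2 by rewrite divr_gt0.
by rewrite Normc.normcV -invf_div lef_pV2 ?posrE // (lt_le_trans r2).
Qed.

Let M0 : 0 <= M. Proof. exact: annulus_bound_ge0 B. Qed.

(** A weak maximum principle.  In the Cauchy formula the kernel is at most 2 / rho on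
    the boundary, integration costs a factor 16 rho by [square_bound], and
    division by [wind 1 0] gains a factor 4. *)
Lemma cauchy_sup t : N t <= rho / 2 -> N (h t) <= 8 * M.
Proof.
move=> tr; have W := wind_neq0.
have cv := square_continuous_subV rho0 tr.
have -> : h t = square rho (fun z => h z * (z - t)^-1) / wind 1 0.
  by rewrite cauchy_formula // wind_const // mulfK.
apply: le_div_wind; first by rewrite mulr_ge0.
have -> : 4 * (8 * M) = 16 * (M * (2 / rho)) * rho by field; rewrite gt_eqF.
apply: (square_bound rho0 (square_continuousM ch cv)) => z Ez; rewrite Normc.normcM.
by apply: ler_pM; rewrite ?normc_ge0 //; [exact: hM|exact: vM].
Qed.

(** Expand the Cauchy kernel 1/(z - t) to third order in t.  Three terms are
    needed because the quotient of a function by t has to be shown differentiable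
    at 0 with a quadratic remainder. *)
Lemma taylor : exists c1 c2 : C, [/\ N c1 <= 4 * M / rho, N c2 <= 4 * M / rho ^+ 2 &
  forall t, N t <= rho / 2 ->
    N (h t - h 0 - c1 * t - c2 * t ^+ 2) <= 8 * M / rho ^+ 3 * N t ^+ 3].
Proof.
have W := wind_neq0.
have rr : - rho <= rho by have := rho0; lra.
have c2 : square_continuous rho (fun z => u z * u z) by exact: square_continuousM.
have c3 : square_continuous rho (fun z => u z * (u z * u z)).
  exact: square_continuousM.
have cf1 := square_continuousM ch cu.
have cf2 := square_continuousM ch c2.
have cf3 := square_continuousM ch c3.
pose m1 := square rho (fun z => h z * (u z * u z)).
pose m2 := square rho (fun z => h z * (u z * (u z * u z))).
have rhoN0 : rho != 0 by rewrite gt_eqF.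
have ri : 0 <= rho^-1 by rewrite invr_ge0 ltW.
have u2 z : square_edge rho z -> N (u z * u z) <= rho^-1 * rho^-1.
  by move=> Ez; rewrite Normc.normcM; apply: ler_pM; rewrite ?normc_ge0 ?uM.
have u3 z : square_edge rho z -> N (u z * (u z * u z)) <= rho^-1 * (rho^-1 * rho^-1).
  by move=> Ez; rewrite Normc.normcM; apply: ler_pM; rewrite ?normc_ge0 ?uM ?u2.
exists (m1 / wind 1 0), (m2 / wind 1 0); split.
- apply: le_div_wind; first by rewrite divr_ge0 ?mulr_ge0 // ltW.
  have -> : 4 * (4 * M / rho) = 16 * (M * (rho^-1 * rho^-1)) * rho by field.
  apply: (square_bound rho0 cf2) => z Ez; rewrite Normc.normcM.
  by apply: ler_pM; rewrite ?normc_ge0 ?hM ?u2.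
- apply: le_div_wind; first by rewrite divr_ge0 ?mulr_ge0 ?exprn_ge0 // ltW.
  have -> : 4 * (4 * M / rho ^+ 2) = 16 * (M * (rho^-1 * (rho^-1 * rho^-1))) * rho.
    by field.
  apply: (square_bound rho0 cf3) => z Ez; rewrite Normc.normcM.
  by apply: ler_pM; rewrite ?normc_ge0 ?hM ?u3.
move=> t tr; have cv := square_continuous_subV rho0 tr.
have c4 := square_continuousM c3 cv.
have cf4 := square_continuousM ch c4.
pose r := square rho (fun z => h z * (u z * (u z * u z) * (z - t)^-1)).
have ck := @square_continuous_cst R rho.
have cg2 := square_continuousM (ck t) cf2.
have cg3 := square_continuousM (ck (t ^+ 2)) cf3.
have cg4 := square_continuousM (ck (t ^+ 3)) cf4.
have E : h t * wind 1 0 = h 0 * wind 1 0 + t * m1 + t ^+ 2 * m2 + t ^+ 3 * r.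
  have Ft := cauchy_formula dh rho0 tr; have F0 := cauchy_formula dh rho0 N0.
  rewrite (wind_const rho0 tr) in Ft; rewrite (wind_const rho0 N0) in F0.
  rewrite -Ft -F0.
  rewrite /m1 /m2 /r /square -(rect_intZ _ rr rr cf2) -(rect_intZ _ rr rr cf3).
  have cD phi psi : square_continuous rho phi -> square_continuous rho psi ->
      square_continuous rho (fun z => phi z + psi z).
    move=> k1 k2 z Ez; apply: (@continuousD C C C phi psi); [exact: k1|exact: k2].
  rewrite -(rect_intZ _ rr rr cf4) -(rect_intD rr rr cf1 cg2).
  rewrite -(rect_intD rr rr (cD _ _ cf1 cg2) cg3).
  rewrite -(rect_intD rr rr (cD _ _ (cD _ _ cf1 cg2) cg3) cg4).
  apply: eq_rect_int => // z Ez.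
  have znt := square_edge_neq rho0 tr Ez; have zn0 := square_edge_neq rho0 N0 Ez.
  have zt0 : z - t != 0 by rewrite subr_eq0.
  by rewrite /u subr0; field; apply/andP.
have -> : h t - h 0 - m1 / wind 1 0 * t - m2 / wind 1 0 * t ^+ 2 =
    (t ^+ 3 * r) / wind 1 0.
  have -> : h t = (h 0 * wind 1 0 + t * m1 + t ^+ 2 * m2 + t ^+ 3 * r) / wind 1 0.
    by rewrite -E mulfK.
  by field.
apply: le_div_wind.
  by rewrite mulr_ge0 ?divr_ge0 ?mulr_ge0 ?exprn_ge0 ?normc_ge0 // ltW.
rewrite Normc.normcM normcX.
have -> : 4 * (8 * M / rho ^+ 3 * N t ^+ 3) =
  N t ^+ 3 * (16 * (M * (rho^-1 * (rho^-1 * rho^-1) * (2 / rho))) * rho) by field.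
apply: ler_wpM2l; first by rewrite exprn_ge0 ?normc_ge0.
apply: (square_bound rho0 cf4) => z Ez; rewrite Normc.normcM.
apply: ler_pM; rewrite ?normc_ge0 ?hM // Normc.normcM.
by apply: ler_pM; rewrite ?normc_ge0 ?u3 ?vM.
Qed.

Lemma cauchy_estimate : N (derive1 h 0) <= 4 * M / rho /\
  forall t, N t <= rho / 2 ->
    N (h t - h 0 - derive1 h 0 * t) <= 8 * M / rho ^+ 2 * N t ^+ 2 /\
    N (h t - h 0) <= 8 * M / rho * N t.
Proof.
have [c1 [c2 [b1 b2 T]]] := taylor.
have r2 : 0 < rho / 2 by rewrite divr_gt0.
have rhoN0 : rho != 0 by rewrite gt_eqF.
have ri : 0 < rho^-1 by rewrite invr_gt0.
have T1 t : N t <= rho / 2 ->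
    N (h t - h 0 - c1 * t) <= 8 * M / rho ^+ 2 * N t ^+ 2.
  move=> tr; have := T t tr; have t0 := normc_ge0 t.
  have := normcD (h t - h 0 - c1 * t - c2 * t ^+ 2) (c2 * t ^+ 2).
  rewrite subrK Normc.normcM normcX => H1 H2.
  have H3 : 8 * M / rho ^+ 3 * N t ^+ 3 <= 4 * M / rho ^+ 2 * N t ^+ 2.
    have -> : 8 * M / rho ^+ 3 * N t ^+ 3 =
      (8 * M / rho ^+ 3 * N t ^+ 2) * N t by ring.
    have -> : 4 * M / rho ^+ 2 * N t ^+ 2 =
      (8 * M / rho ^+ 3 * N t ^+ 2) * (rho / 2) by field.
    apply: ler_wpM2l => //.
    by rewrite !mulr_ge0 ?invr_ge0 ?exprn_ge0 // ltW.
  have H4 : N c2 * N t ^+ 2 <= 4 * M / rho ^+ 2 * N t ^+ 2.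
    by apply: ler_wpM2r => //; rewrite exprn_ge0.
  by lra.
have [|_ D] := @quadratic_remainder R h 0 c1 (rho / 2) (8 * M / rho ^+ 2) r2.
  by move=> t /ltW tr; rewrite add0r; exact: T1.
rewrite D; split=> // t tr; split; first exact: T1.
have := T1 t tr; have t0 := normc_ge0 t.
have := normcD (h t - h 0 - c1 * t) (c1 * t).
rewrite subrK Normc.normcM => H1 H2.
have H3 : 8 * M / rho ^+ 2 * N t ^+ 2 <= 4 * M / rho * N t.
  have -> : 8 * M / rho ^+ 2 * N t ^+ 2 = (8 * M / rho ^+ 2 * N t) * N t by ring.
  have -> : 4 * M / rho * N t = (8 * M / rho ^+ 2 * N t) * (rho / 2) by field.
  apply: ler_wpM2l => //.
  by rewrite !mulr_ge0 ?invr_ge0 ?exprn_ge0 // ltW.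
have H4 : N c1 * N t <= 4 * M / rho * N t by apply: ler_wpM2r.
by lra.
Qed.

End Estimates.

Lemma differentiable_near_eq (f g : C -> C) z (d : R) : 0 < d ->
  (forall w, N w < d -> f (z + w) = g (z + w)) ->
  differentiable f z -> differentiable g z.
Proof.
move=> d0 E df; apply: (@eps_derive1 R g z (derive1 f z)) => e e0.
have [d1 d10 H] := derive1_eps df e0.
exists (Num.min d d1); first by rewrite lt_min d0.
move=> w; rewrite lt_min => /andP[wd /H].
by rewrite E // -[in X in _ -> X](addr0 z) -[in g (z + 0)]E ?addr0 // Normc.normc0.
Qed.

Lemma continuous_bounded h z (e : R) : 0 < e -> differentiable h z ->
  exists2 d : R, 0 < d & forall w, N w < d -> N (h (z + w) - h z) < e.
Proof.
move=> e0 /differentiable_continuous_at /continuous_epsP /(_ e e0)[d d0 H].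
exists d => // w wd; apply: H; rewrite addrC addKr normrc ltcR //.
Qed.

Lemma entire_local_bound h : entire h ->
  exists2 rho : R, 0 < rho & exists M, annulus_bound h rho M.
Proof.
move=> dh; have [d d0 H] := continuous_bounded (@ltr01 R) (dh 0).
exists (d / 4); first by rewrite divr_gt0.
exists (N (h 0) + 1) => z /andP[_ zr].
have := H z; rewrite add0r => /(_ ltac:(lra)) Hz.
by have := normcD (h z - h 0) (h 0); rewrite subrK; lra.
Qed.

(** At 0 the derivative of h(t)/t is the second Taylor coefficient of h. *)
Theorem removable_singularity h : entire h -> h 0 = 0 ->
  entire (fun t => if t == 0 then derive1 h 0 else h t / t).
Proof.
move=> dh h0 z; have [->|z0] := eqVneq z 0; last first.
  apply: (@differentiable_near_eq (fun t => h t * (t - 0)^-1) _ z (N z)).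
  - by rewrite normc_gt0.
  - move=> w wz; rewrite subr0 ifN //; apply/eqP => E.
    have : w = - z by apply/eqP; rewrite -addr_eq0 addrC E.
    by move=> wE; move: wz; rewrite wE normcN ltxx.
  - by apply: differentiableM; [exact: dh|exact: differentiable_subV].
have [rho rho0 [M B]] := entire_local_bound dh.
have [c1 [c2 [b1 b2 T]]] := taylor dh rho0 B.
have [_ E1] := cauchy_estimate dh rho0 B.
have r2 : 0 < rho / 2 by rewrite divr_gt0.
have D : derive1 h 0 = c1.
  have M0 := annulus_bound_ge0 rho0 B.
  have [//|//] := @quadratic_remainder R h 0 c1 (rho / 2)
     (8 * M / rho ^+ 3 * (rho / 2) + N c2) r2.
  move=> t /ltW tr; rewrite add0r; have := T t tr; have t0 := normc_ge0 t.
  have := normcD (h t - h 0 - c1 * t - c2 * t ^+ 2) (c2 * t ^+ 2).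
  rewrite subrK Normc.normcM normcX => H1 H2.
  have H3 : 8 * M / rho ^+ 3 * N t ^+ 3 <= 8 * M / rho ^+ 3 * (rho / 2) * N t ^+ 2.
    have -> : 8 * M / rho ^+ 3 * N t ^+ 3 =
      (8 * M / rho ^+ 3 * N t ^+ 2) * N t by ring.
    have -> : 8 * M / rho ^+ 3 * (rho / 2) * N t ^+ 2 =
      (8 * M / rho ^+ 3 * N t ^+ 2) * (rho / 2) by ring.
    apply: ler_wpM2l => //.
    by rewrite !mulr_ge0 ?invr_ge0 ?exprn_ge0 // ltW.
  by lra.
have [//|//] := @quadratic_remainder R (fun t => if t == 0 then derive1 h 0 else h t / t)
  0 c2 (rho / 2) (8 * M / rho ^+ 3) r2.
move=> t /ltW tr; rewrite add0r eqxx.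
have [->|t0] := eqVneq t 0.
  by rewrite subrr mulr0 subrr Normc.normc0 expr0n mulr0.
have Nt : 0 < N t by rewrite normc_gt0.
have -> : h t / t - derive1 h 0 - c2 * t = (h t - h 0 - c1 * t - c2 * t ^+ 2) / t.
  by rewrite h0 D; field.
rewrite Normc.normcM Normc.normcV ler_pdivrMr // -[leRHS]mulrA -exprSr.
exact: T.
Qed.

(** Completeness for families indexed by a real parameter tending to 0, with a
    linear rate: the supremum of the lower bounds x s - B s is the limit. *)
Lemma cauchy_net (s0 B : R) (x : R -> R) : 0 < s0 ->
  (forall s s', 0 < s <= s0 -> 0 < s' <= s0 -> `|x s - x s'| <= B * (s + s')) ->
  exists X, forall s, 0 < s <= s0 -> `|x s - X| <= B * s.
Proof.
move=> s00 H.
pose A := [set y | exists2 s, 0 < s <= s0 & y = x s - B * s].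
have ub s : 0 < s <= s0 -> ubound A (x s + B * s).
  move=> ss _ [s' ss' ->]; have := H s s' ss ss'.
  by rewrite ler_norml => /andP[]; lra.
have hs : has_sup A.
  split; first by exists (x s0 - B * s0), s0 => //; rewrite s00 lexx.
  by exists (x s0 + B * s0); apply: ub; rewrite s00 lexx.
exists (sup A) => s ss; rewrite ler_norml.
have h1 : sup A <= x s + B * s by apply: sup_le_ub; [exact: hs.1|exact: ub].
have h2 : x s - B * s <= sup A by apply: sup_upper_bound => //; exists s.
by apply/andP; split; lra.
Qed.

Lemma le_lim0 (s0 B x y : R) : 0 < s0 ->
  (forall s, 0 < s <= s0 -> x <= y + B * s) -> x <= y.
Proof.
move=> s00 H; rewrite -subr_le0; apply: (@le0_archi _ _ `|B| s0^-1) => s rs.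
have s1 : 0 < s by apply: lt_le_trans rs; rewrite invr_gt0.
have := H s^-1; rewrite invr_gt0 s1 invf_ple ?posrE // => /(_ rs).
rewrite -lerBlDl ler_pdivlMr //; have := ler_norm B; lra.
Qed.

(** Weierstrass: differentiability passes to uniform limits.  The derivatives
    of the approximations at 0 converge by the Cauchy estimate, and the
    quadratic Taylor estimates are uniform in s. *)
Theorem uniform_limit_differentiable phi (psi : R -> C -> C) (rho s0 A M : R) :
  0 < rho -> 0 < s0 ->
  (forall s, 0 < s <= s0 -> entire (psi s)) ->
  (forall s t, 0 < s <= s0 -> N t <= 2 * rho -> N (psi s t - phi t) <= A * s) ->
  (forall t, N t <= 2 * rho -> N (phi t) <= M) ->
  differentiable phi 0.
Proof.
move=> r0 s00 dpsi psiA phiM.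
have sub_entire s s' : 0 < s <= s0 -> 0 < s' <= s0 ->
    entire (fun t => psi s t - psi s' t).
  by move=> ss ss' z; apply: differentiableB; exact: dpsi.
have A0 : 0 <= A.
  have := psiA s0 0; rewrite s00 lexx Normc.normc0 => /(_ isT) H.
  have r2' : 0 <= 2 * rho by lra.
  by have := le_trans (normc_ge0 _) (H r2'); rewrite pmulr_lge0.
pose D s := derive1 (psi s) 0.
have DD s s' : 0 < s <= s0 -> 0 < s' <= s0 ->
    N (D s - D s') <= 4 * A / rho * (s + s').
  move=> ss ss'.
  have B : annulus_bound (fun t => psi s t - psi s' t) rho (A * (s + s')).
    move=> z /andP[_ zr].
    have -> : psi s z - psi s' z = (psi s z - phi z) - (psi s' z - phi z) by ring.
    apply: le_trans (normcB _ _) _.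
    by have := psiA _ _ ss zr; have := psiA _ _ ss' zr; lra.
  have [H _] := cauchy_estimate (sub_entire _ _ ss ss') r0 B.
  have E : derive1 (fun t => psi s t - psi s' t) 0 = D s - D s'.
    rewrite /D !derive1E; apply: deriveB; apply/diff_derivable; exact: dpsi.
  by move: H; rewrite E; lra.
have [X HX] : exists X, forall s, 0 < s <= s0 -> `|Re (D s) - X| <= 4 * A / rho * s.
  apply: cauchy_net => // s s' ss ss'; apply: le_trans (DD _ _ ss ss').
  by rewrite -cReN -cReD; exact: normc_geRe.
have [Y HY] : exists Y, forall s, 0 < s <= s0 -> `|Im (D s) - Y| <= 4 * A / rho * s.
  apply: cauchy_net => // s s' ss ss'; apply: le_trans (DD _ _ ss ss').
  by rewrite -cImN -cImD; exact: normc_geIm.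
have r2 : 0 < rho / 2 by rewrite divr_gt0.
pose M' := M + A * s0.
have [//|//] := @quadratic_remainder R phi 0 (X +i* Y) (rho / 2) (8 * M' / rho ^+ 2) r2.
move=> t /ltW tr; rewrite add0r.
have t0 := normc_ge0 t.
have tr2 : N t <= 2 * rho by lra.
have z2 : N 0 <= 2 * rho by rewrite Normc.normc0; lra.
apply: (@le_lim0 s0 (2 * A + 8 * A / rho * N t)) => // s ss.
have DX : N (D s - (X +i* Y)) <= 8 * A / rho * s.
  apply: le_trans (normc_leReIm _) _; rewrite !cReImE /=.
  by have := HX s ss; have := HY s ss; lra.
have B : annulus_bound (psi s) rho M'.
  move=> z /andP[_ zr].
  have := normcD (psi s z - phi z) (phi z); rewrite subrK.
  have := psiA _ _ ss zr; have := phiM _ zr; rewrite /M'.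
  have /andP[_ ss0] := ss; nra.
have [_ /(_ t tr)[H _]] := cauchy_estimate (dpsi s ss) r0 B.
have p1 := psiA s t ss tr2; have p2 := psiA s 0 ss z2.
have -> : phi t - phi 0 - (X +i* Y) * t = (psi s t - psi s 0 - D s * t) -
   (psi s t - phi t) + (psi s 0 - phi 0) + (D s - (X +i* Y)) * t by ring.
apply: le_trans (normcD _ _) _; rewrite Normc.normcM.
have q1 := normcD (psi s t - psi s 0 - D s * t - (psi s t - phi t)) (psi s 0 - phi 0).
have q2 := normcB (psi s t - psi s 0 - D s * t) (psi s t - phi t).
have q3 : N (D s - (X +i* Y)) * N t <= 8 * A / rho * s * N t by apply: ler_wpM2r.
rewrite -/(D s) in H; lra.
Qed.

End OneVariable.

(** * Osgood's lemma *)

Section SeveralVariables.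
Variable R : realType.
Local Notation C := R[i].
Local Notation N := (@Normc.normc R).
Local Notation V := 'rV[R[i]]_3.
Implicit Types (f g : V -> C) (p v : V) (k j : 'I_3).

(** The norm of a vector over the complex numbers is itself a complex number;
    this is its real value. *)
Definition vnorm v : R := Re `|v|.

Lemma vnormE v : `|v| = (vnorm v)%:C.
Proof.
have : 0 <= `|v| := normr_ge0 v.
by rewrite /vnorm; case: `|v| => a b; rewrite lecE /= => /andP[/eqP -> _].
Qed.

Lemma vnorm_ge0 v : 0 <= vnorm v.
Proof. by rewrite -ler0c -vnormE. Qed.

Lemma coord_le v i : N (v 0 i) <= vnorm v.
Proof.
rewrite -lecR -vnormE -normrc -[leLHS]nngE -[leRHS]nngE num_le /=.
exact: (le_bigmax _ (fun ij : 'I_1 * 'I_3 => `|v ij.1 ij.2|%:nng) (0, i)).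
Qed.

Lemma vnorm_le v (d : R) : 0 <= d -> (forall i, N (v 0 i) <= d) -> vnorm v <= d.
Proof.
move=> d0 H; have [v0|/mx_norm_neq0[[a i] E]] := eqVneq (mx_norm v) 0.
  by rewrite -lecR -vnormE [`|v|]v0 lecR.
by rewrite -lecR -vnormE [`|v|]E /= normrc lecR (ord1 a).
Qed.

Definition axis_line f p k : C -> C := fun t => f (p + t *: delta_mx 0 k).

Lemma row3_eta v : v = row3 (v 0 0) (v 0 1) (v 0 2).
Proof.
apply/rowP => -[[|[|[|//]]] i]; rewrite mxE /=; congr (v _ _); exact: val_inj.
Qed.

Lemma row3E (a b c : C) : (row3 a b c 0 0 = a) * (row3 a b c 0 1 = b) * (row3 a b c 0 2 = c).
Proof. by rewrite !mxE. Qed.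

Lemma ord3_ind (P : 'I_3 -> Prop) : P 0 -> P 1 -> P 2 -> forall i, P i.
Proof.
move=> P0 P1 P2 [[|[|[|//]]] i].
- by rewrite (_ : Ordinal i = 0) //; exact: val_inj.
- by rewrite (_ : Ordinal i = 1) //; exact: val_inj.
- by rewrite (_ : Ordinal i = 2) //; exact: val_inj.
Qed.

Lemma differentiable_axis_line p k (t : C) :
  differentiable (fun t : C => p + t *: (delta_mx 0 k : V)) t.
Proof.
apply: differentiableD; first exact: differentiable_cst.
by apply: differentiableZl; exact: ex_diff.
Qed.

Lemma axis_line_entire f p k : holomorphic f -> entire (axis_line f p k).
Proof.
move=> df t; apply: (differentiable_comp (differentiable_axis_line p k t)).
exact: df.
Qed.

Lemma differentiable_shift (h : C -> C) (t : C) :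
  differentiable (fun s => h (t + s)) 0 -> differentiable h t.
Proof.
move=> dh; apply: (@eps_derive1 R h t (derive1 (fun s => h (t + s)) 0)) => e e0.
have [d d0 H] := derive1_eps dh e0; exists d => // w /H.
by rewrite add0r addr0.
Qed.

Lemma entire_shift (h : C -> C) (t : C) : entire h -> entire (fun s => h (t + s)).
Proof.
move=> dh z; apply: (@differentiable_comp _ _ _ _ (fun s => t + s) h); last exact: dh.
by apply: differentiableD; [exact: differentiable_cst|exact: ex_diff].
Qed.

Definition box_bound f p (r M : R) :=
  forall v, (forall i, N (v 0 i) <= r) -> N (f (p + v)) <= M.

Lemma differentiable_box_bound f p (r0 : R) : 0 < r0 -> differentiable f p ->
  exists r M : R, [/\ 0 < r, r <= r0 & box_bound f p r M].
Proof.
move=> r00 /differentiable_continuous /continuous_epsP /(_ 1 ltr01)[d d0 H].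
exists (Num.min (d / 2) r0), (N (f p) + 1); split.
- by rewrite lt_min r00 divr_gt0.
- by rewrite ge_min lexx orbT.
move=> v vr; have := H (p + v).
rewrite addrC addKr vnormE ltcR => Hv.
have /Hv : vnorm v < d.
  apply: (@le_lt_trans _ _ (d / 2)); last by lra.
  apply: vnorm_le => [|i]; first by rewrite divr_ge0 // ltW.
  by apply: le_trans (vr i) _; rewrite ge_min lexx.
by have := normcD (f (v + p) - f p) (f p); rewrite subrK addrC; lra.
Qed.

Lemma telescope3 (x0 x1 x2 x3 a b c e0 e1 e1' e2 e2' : C) :
  x3 - x0 - (a * e0 + b * e1' + c * e2') =
  ((x3 - x2 - e2 * c) + (x2 - x1 - e1 * b) + (x1 - x0 - e0 * a)) +
  ((e1 - e1') * b + (e2 - e2') * c).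
Proof. by ring. Qed.

Section Osgood.
Variables (G : C -> C -> C -> C) (rho M : R).
Hypotheses (r0 : 0 < rho).
Hypotheses (d0 : forall b c, entire (fun z => G z b c))
  (d1 : forall a c, entire (fun z => G a z c)) (d2 : forall a b, entire (G a b)).
Hypothesis B : forall a b c, N a <= 2 * rho -> N b <= 2 * rho -> N c <= 2 * rho ->
  N (G a b c) <= M.

(** Change the three coordinates one at a time.  Each change has a quadratic
    Taylor remainder; its linear coefficient is a derivative at a displaced
    point, and the Cauchy estimate, applied to the difference of two
    slices, shows that the displacement costs O(r).  The constant is
    120 = 3 * 8 + 32 + 64: three Taylor remainders and two displacements. *)
Lemma osgood_estimate : exists D0 D1 D2 : C, forall (r : R) a b c, r <= rho / 2 ->
  N a <= r -> N b <= r -> N c <= r ->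
  N (G a b c - G 0 0 0 - (a * D0 + b * D1 + c * D2)) <= 120 * M / rho ^+ 2 * r ^+ 2.
Proof.
pose D0 := derive1 (fun z => G z 0 0) 0.
pose D1 a := derive1 (fun z => G a z 0) 0.
pose D2 a b := derive1 (fun z => G a b z) 0.
exists D0, (D1 0), (D2 0 0) => r a b c rr ar br cr.
have z0 s : 0 <= s -> N 0 <= s by rewrite Normc.normc0.
have r20 : 0 <= 2 * rho by rewrite mulr_ge0 // ltW.
have ge0r : 0 <= r := le_trans (normc_ge0 a) ar.
have r2 : r <= 2 * rho by have := r0; lra.
have B0 b' c' : N b' <= 2 * rho -> N c' <= 2 * rho ->
    annulus_bound (fun z => G z b' c') rho M.
  by move=> hb hc z /andP[_ hz]; exact: B.
have B1 a' c' : N a' <= 2 * rho -> N c' <= 2 * rho ->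
    annulus_bound (fun z => G a' z c') rho M.
  by move=> hb hc z /andP[_ hz]; exact: B.
have B2 a' b' : N a' <= 2 * rho -> N b' <= 2 * rho ->
    annulus_bound (fun z => G a' b' z) rho M.
  by move=> hb hc z /andP[_ hz]; exact: B.
have le2 x : N x <= r -> N x <= 2 * rho by move=> /le_trans; apply.
have leh x : N x <= r -> N x <= rho / 2 by move=> /le_trans; apply.
have M0 : 0 <= M by apply: annulus_bound_ge0 r0 (B0 0 0 _ _); exact: z0.
have ir0 : 0 <= rho^-1 by rewrite invr_ge0 ltW.
have K0 : 0 <= 8 * M / rho by rewrite !mulr_ge0.
have K1 : 0 <= 8 * M / rho ^+ 2 by rewrite !mulr_ge0 ?invr_ge0 ?exprn_ge0 // ltW.
have sq x (Q : R) : N x <= r -> 0 <= Q -> Q * N x ^+ 2 <= Q * r ^+ 2.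
  by move=> xr Q0; apply: ler_wpM2l => //; rewrite lerXn2r ?nnegrE ?normc_ge0.
have s0 : N (G a 0 0 - G 0 0 0 - D0 * a) <= 8 * M / rho ^+ 2 * r ^+ 2.
  have [_ /(_ a (leh _ ar))[H _]] :=
    cauchy_estimate (d0 0 0) r0 (B0 0 0 (z0 _ r20) (z0 _ r20)).
  exact: le_trans H (sq _ _ ar K1).
have s1 : N (G a b 0 - G a 0 0 - D1 a * b) <= 8 * M / rho ^+ 2 * r ^+ 2.
  have [_ /(_ b (leh _ br))[H _]] :=
    cauchy_estimate (d1 a 0) r0 (B1 a 0 (le2 _ ar) (z0 _ r20)).
  exact: le_trans H (sq _ _ br K1).
have s2 : N (G a b c - G a b 0 - D2 a b * c) <= 8 * M / rho ^+ 2 * r ^+ 2.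
  have [_ /(_ c (leh _ cr))[H _]] :=
    cauchy_estimate (d2 a b) r0 (B2 a b (le2 _ ar) (le2 _ br)).
  exact: le_trans H (sq _ _ cr K1).
have dB (h1 h2 : C -> C) : entire h1 -> entire h2 ->
    entire (fun z => h1 z - h2 z) /\
    derive1 (fun z => h1 z - h2 z) 0 = derive1 h1 0 - derive1 h2 0.
  move=> e1 e2; split; first by move=> z; apply: differentiableB.
  by rewrite !derive1E; apply: deriveB; exact/diff_derivable.
have la x b' c' : N x <= r -> N b' <= 2 * rho -> N c' <= 2 * rho ->
    N (G x b' c' - G 0 b' c') <= 8 * M / rho * r.
  move=> xr hb hc; have [_ /(_ x (leh _ xr))[_ H]] :=
    cauchy_estimate (d0 b' c') r0 (B0 b' c' hb hc).
  by apply: le_trans H _; exact: ler_wpM2l.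
have lb x a' c' : N x <= r -> N a' <= 2 * rho -> N c' <= 2 * rho ->
    N (G a' x c' - G a' 0 c') <= 8 * M / rho * r.
  move=> xr hb hc; have [_ /(_ x (leh _ xr))[_ H]] :=
    cauchy_estimate (d1 a' c') r0 (B1 a' c' hb hc).
  by apply: le_trans H _; exact: ler_wpM2l.
have t1 : N (D1 a - D1 0) <= 4 * (8 * M / rho * r) / rho.
  have [e1 E1] := dB _ _ (d1 a 0) (d1 0 0); rewrite /D1 -E1.
  have A1 : annulus_bound (fun z => G a z 0 - G 0 z 0) rho (8 * M / rho * r).
    by move=> z /andP[_ hz]; apply: la => //; exact: z0.
  by have [] := cauchy_estimate e1 r0 A1.
have t2 : N (D2 a b - D2 0 0) <= 4 * (16 * M / rho * r) / rho.
  have [e1 E1] := dB _ _ (d2 a b) (d2 0 0); rewrite /D2 -E1.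
  have A1 : annulus_bound (fun z => G a b z - G 0 0 z) rho (16 * M / rho * r).
    move=> z /andP[_ hz].
    have := la a b z ar (le2 _ br) hz; have := lb b 0 z br (z0 _ r20) hz.
    have := normcD (G a b z - G 0 b z) (G 0 b z - G 0 0 z).
    by rewrite addrA subrK; lra.
  by have [] := cauchy_estimate e1 r0 A1.
rewrite (telescope3 _ (G a 0 0) (G a b 0) _ _ _ _ _ (D1 a) _ (D2 a b)).
have u1 : N ((D1 a - D1 0) * b) <= 4 * (8 * M / rho * r) / rho * r.
  by rewrite Normc.normcM; apply: ler_pM; rewrite ?normc_ge0.
have u2 : N ((D2 a b - D2 0 0) * c) <= 4 * (16 * M / rho * r) / rho * r.
  by rewrite Normc.normcM; apply: ler_pM; rewrite ?normc_ge0.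
have w1 := normcD ((D1 a - D1 0) * b) ((D2 a b - D2 0 0) * c).
have w2 := normcD (G a b c - G a b 0 - D2 a b * c + (G a b 0 - G a 0 0 - D1 a * b))
   (G a 0 0 - G 0 0 0 - D0 * a).
have w3 := normcD (G a b c - G a b 0 - D2 a b * c) (G a b 0 - G a 0 0 - D1 a * b).
apply: le_trans (normcD _ _) _; apply: le_trans (lerD (le_trans w2
  (lerD (le_trans w3 (lerD s2 s1)) s0)) (le_trans w1 (lerD u1 u2))) _.
by rewrite le_eqVlt; apply/orP; left; apply/eqP; field; rewrite gt_eqF.
Qed.

End Osgood.

Lemma axis_line_row3 f p (a b c : C) :
  ((fun z => f (p + row3 z b c)) = axis_line f (p + row3 0 b c) 0) *
  ((fun z => f (p + row3 a z c)) = axis_line f (p + row3 a 0 c) 1) *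
  ((fun z => f (p + row3 a b z)) = axis_line f (p + row3 a b 0) 2).
Proof.
by do ?[split]; apply/funext => z; rewrite /axis_line -addrA; congr (f (_ + _));
  apply/rowP; apply: ord3_ind; rewrite !mxE /= ?(mulr0, mulr1, addr0, add0r).
Qed.

Definition linear_form3 (D0 D1 D2 : C) (v : V) : C :=
  v 0 0 * D0 + v 0 1 * D1 + v 0 2 * D2.

Lemma linear_form3_is_linear D0 D1 D2 : linear (linear_form3 D0 D1 D2 : V -> C^o).
Proof.
move=> c v w; rewrite /linear_form3 !mxE.
by rewrite [RHS](_ : _ = c * (v 0 0 * D0 + v 0 1 * D1 + v 0 2 * D2) +
  (w 0 0 * D0 + w 0 1 * D1 + w 0 2 * D2)) //; ring.
Qed.

HB.instance Definition _ D0 D1 D2 := GRing.isLinear.Build C V C^o *:%R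
  (linear_form3 D0 D1 D2) (linear_form3_is_linear D0 D1 D2).

(** Osgood's lemma: the linear form with the coefficients of [osgood_estimate] is the
    differential, since the remainder there is quadratic. *)
Theorem osgood g p (rho M : R) : (forall q k, entire (axis_line g q k)) -> 0 < rho ->
  box_bound g p (2 * rho) M -> differentiable g p.
Proof.
move=> dg r0 B; pose G a b c := g (p + row3 a b c).
have [D0 [D1 [D2 H]]] : exists D0 D1 D2 : C, forall (r : R) a b c, r <= rho / 2 ->
    N a <= r -> N b <= r -> N c <= r ->
    N (G a b c - G 0 0 0 - (a * D0 + b * D1 + c * D2)) <= 120 * M / rho ^+ 2 * r ^+ 2.
  apply: osgood_estimate => //.
  - by move=> b c; rewrite /G !(axis_line_row3 _ _ 0 b c); exact: dg.
  - by move=> a c; rewrite /G !(axis_line_row3 _ _ a 0 c); exact: dg.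
  - by move=> a b; rewrite /G !(axis_line_row3 _ _ a b 0); exact: dg.
  - by move=> a b c ha hb hc; apply: B; apply: ord3_ind; rewrite row3E.
apply: (@eps_differentiable R V g (linear_form3 D0 D1 D2)).
  move=> v; rewrite /linear_form3.
  apply: (@continuousD C C V (fun v : V => v 0 0 * D0 + v 0 1 * D1)
     (fun v : V => v 0 2 * D2)).
    apply: (@continuousD C C V (fun v : V => v 0 0 * D0) (fun v : V => v 0 1 * D1));
    by apply: (@continuousM C V _ (fun=> _)); [exact: coord_continuous|exact: cst_continuous].
  by apply: (@continuousM C V _ (fun=> _)); [exact: coord_continuous|exact: cst_continuous].
move=> e e0; set K := 120 * M / rho ^+ 2 in H.
have K0 : 0 < `|K| + 1 by rewrite ltr_wpDl.
exists (Num.min (rho / 2) (e / (`|K| + 1))); first by rewrite lt_min !divr_gt0.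
move=> v; rewrite vnormE ltcR lt_min => /andP[/ltW v1]; rewrite ltr_pdivlMr // => v2.
rewrite normrc -rmorphM lecR.
have := H (vnorm v) (v 0 0) (v 0 1) (v 0 2) v1 (coord_le _ _) (coord_le _ _) (coord_le _ _).
rewrite /G -row3_eta (_ : row3 0 0 0 = 0); last first.
  by apply/rowP; apply: ord3_ind; rewrite !mxE.
rewrite addr0 => /le_trans; apply; rewrite expr2 mulrA.
by have := vnorm_ge0 v; have := ler_norm K; nra.
Qed.

End SeveralVariables.

(** * Division by a coordinate *)

Section Division.
Variable R : realType.
Local Notation C := R[i].
Local Notation N := (@Normc.normc R).
Local Notation V := 'rV[R[i]]_3.
Implicit Types (f g : V -> C) (p v x : V) (k j : 'I_3).

Lemma coord_line x k j (t : C) :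
  (x + t *: delta_mx 0 k) 0 j = x 0 j + (if j == k then t else 0).
Proof. by rewrite !mxE eqxx /= eq_sym; case: eqP => _; rewrite ?mulr1 ?mulr0. Qed.

Lemma axis_norm k (t : C) (r : R) : N t <= r -> forall i,
  N ((t *: delta_mx 0 k : V) 0 i) <= r.
Proof.
move=> tr i; rewrite !mxE eqxx /=; case: (i == k) => /=; first by rewrite mulr1.
by rewrite mulr0 Normc.normc0 (le_trans (normc_ge0 t)).
Qed.

Section Quotient.
Variables (f : V -> C) (j : 'I_3).
Hypotheses (fh : holomorphic f) (f0 : forall x, x 0 j = 0 -> f x = 0).

(** f / x_j, completed by the derivative of f along the j-th axis. *)
Definition coord_quotient x : C :=
  if x 0 j == 0 then derive1 (axis_line f x j) 0 else f x / x 0 j.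

Lemma coord_quotientP x : f x = x 0 j * coord_quotient x.
Proof.
rewrite /coord_quotient; case: eqP => [/[dup] /f0 -> ->|/eqP x0].
  by rewrite mul0r.
by field.
Qed.

Lemma line_bound x k (r M : R) : 0 < r -> box_bound f x (2 * r) M ->
  annulus_bound (axis_line f x k) r M.
Proof.
by move=> r0 B z /andP[_ zr]; apply: B; exact: axis_norm.
Qed.

Lemma coord_quotient_entire_j x : entire (axis_line coord_quotient x j).
Proof.
pose y := x + (- x 0 j) *: delta_mx 0 j.
have yj : y 0 j = 0 by rewrite coord_line eqxx subrr.
have yE t : x + t *: delta_mx 0 j = y + (x 0 j + t) *: delta_mx 0 j.
  by rewrite /y -addrA -scalerDl addKr.
have h0 : axis_line f y j 0 = 0 by rewrite /axis_line scale0r addr0 f0.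
have -> : axis_line coord_quotient x j = fun t =>
    (fun s => if s == 0 then derive1 (axis_line f y j) 0 else axis_line f y j s / s) (x 0 j + t).
  apply/funext => t; rewrite /axis_line yE /coord_quotient coord_line eqxx yj add0r.
  by case: eqP => [->|_]; rewrite ?scale0r ?addr0.
apply: (@entire_shift R (fun s => if s == 0 then derive1 (axis_line f y j) 0 else axis_line f y j s / s)).
by apply: removable_singularity; [exact: axis_line_entire|exact: h0].
Qed.

Lemma box_bound_sub x (y : V) (r r' M : R) : (forall i, N (y 0 i) <= r) ->
  box_bound f x (r + r') M -> box_bound f (x + y) r' M.
Proof.
move=> yr B v vr; rewrite -addrA; apply: B => i; rewrite mxE.
by apply: le_trans (normcD _ _) _; apply: lerD.
Qed.

(** On the hyperplane x_j = 0 the quotient is the uniform limit of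
    f(x + s e_j)/s as s tends to 0. *)
Lemma coord_quotient_estimate x (r M : R) (s : C) : 0 < r -> box_bound f x (2 * r) M ->
  x 0 j = 0 -> N s <= r / 2 ->
  [/\ N (coord_quotient x) <= 4 * M / r,
      N (f (x + s *: delta_mx 0 j) - s * coord_quotient x) <= 8 * M / r ^+ 2 * N s ^+ 2 &
      N (f (x + s *: delta_mx 0 j)) <= 8 * M / r * N s].
Proof.
move=> r0 B xj sr.
have [h1 /(_ s sr)[h2 h3]] := cauchy_estimate (axis_line_entire x j fh) r0 (line_bound j r0 B).
move: h2 h3; rewrite /axis_line scale0r addr0 (f0 xj) !subr0 mulrC.
by rewrite /coord_quotient xj eqxx.
Qed.

(** Along the other axes the only difficulty is inside the hyperplane x_j = 0,
    where the quotient is a limit of holomorphic functions. *)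
Lemma coord_quotient_diff_k x k : k != j ->
  differentiable (axis_line coord_quotient x k) 0.
Proof.
move=> kj; have jk : (j == k) = false by rewrite eq_sym (negbTE kj).
have [xj|xj] := eqVneq (x 0 j) 0; last first.
  have -> : axis_line coord_quotient x k = fun t => axis_line f x k t * (x 0 j)^-1.
    apply/funext => t; rewrite /axis_line /coord_quotient coord_line jk addr0.
    by rewrite (negbTE xj).
  apply: differentiableM; [exact: axis_line_entire|exact: differentiable_cst].
have [r1 [M [r10 _ B]]] := differentiable_box_bound (@ltr01 R) (fh x).
pose r := r1 / 4.
have r0 : 0 < r by rewrite divr_gt0.
have Bt t : N t <= 2 * r -> box_bound f (x + t *: delta_mx 0 k) (2 * r) M.
  move=> tr; apply: (@box_bound_sub _ _ (2 * r)); first exact: axis_norm.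
  by rewrite (_ : 2 * r + 2 * r = r1) // /r; field.
have xt t : (x + t *: delta_mx 0 k) 0 j = 0 by rewrite coord_line jk addr0.
have s0 : 0 < r / 2 by rewrite divr_gt0.
have z0 : N 0 <= r / 2 by rewrite Normc.normc0 ltW.
apply: (@uniform_limit_differentiable R _
  (fun (s : R) t => axis_line f (x + s%:C *: delta_mx 0 j) k t * (s%:C)^-1)
  r (r / 2) (8 * M / r ^+ 2) (4 * M / r)) => //.
- move=> s /andP[sp sr] t.
  apply: differentiableM; [exact: axis_line_entire|exact: differentiable_cst].
- move=> s t /andP[sp sr] tr.
  have Ns : N s%:C = s by rewrite normc_real gtr0_norm.
  have Nsr : N s%:C <= r / 2 by rewrite Ns.
  have [_ H _] := coord_quotient_estimate r0 (Bt t tr) (xt t) Nsr.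
  rewrite Ns in H.
  have sC : s%:C != 0 by rewrite -normc_eq0 Ns gt_eqF.
  have -> : axis_line f (x + s%:C *: delta_mx 0 j) k t / s%:C - axis_line coord_quotient x k t =
    (f (x + t *: delta_mx 0 k + s%:C *: delta_mx 0 j) -
      s%:C * coord_quotient (x + t *: delta_mx 0 k)) / s%:C.
    by rewrite /axis_line [x + _ + _]addrAC; field.
  by rewrite Normc.normcM Normc.normcV Ns ler_pdivrMr // -[leRHS]mulrA -expr2.
- move=> t tr; have [] // := coord_quotient_estimate r0 (Bt t tr) (xt t) z0.
Qed.

Lemma coord_quotient_entire x k : entire (axis_line coord_quotient x k).
Proof.
have [->|kj] := eqVneq k j; first exact: coord_quotient_entire_j.
move=> t; apply: differentiable_shift.
have -> : (fun s => axis_line coord_quotient x k (t + s)) =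
    axis_line coord_quotient (x + t *: delta_mx 0 k) k.
  by apply/funext => s; rewrite /axis_line -addrA -scalerDl.
exact: coord_quotient_diff_k.
Qed.

(** On the hyperplane the bound comes from the Cauchy estimate along the j-th
    axis, based at the projection of the point to the hyperplane. *)
Lemma coord_quotient_bound p : exists r M : R, 0 < r /\
  box_bound coord_quotient p r M.
Proof.
have [pj|pj] := eqVneq (p 0 j) 0; last first.
  have n0 : 0 < N (p 0 j) / 2 by rewrite divr_gt0 // normc_gt0.
  have [r [M [r0 rp B]]] := differentiable_box_bound n0 (fh p).
  exists r, (M / (N (p 0 j) / 2)); split=> // v vr.
  have vj : N (p 0 j) / 2 <= N ((p + v) 0 j).
    by rewrite mxE; have := normcB_ge (p 0 j) (- v 0 j); have := vr j;
      rewrite opprK normcN; lra.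
  have pv0 : 0 < N ((p + v) 0 j) by apply: lt_le_trans vj.
  rewrite /coord_quotient ifN -?normc_gt0 // Normc.normcM Normc.normcV.
  apply: ler_pM; rewrite ?invr_ge0 ?normc_ge0 ?B //.
  by rewrite lef_pV2 ?posrE.
have [r1 [M [r10 _ B]]] := differentiable_box_bound (@ltr01 R) (fh p).
pose r := r1 / 4; have r0 : 0 < r by rewrite divr_gt0.
have z0 : N 0 <= r / 2 by rewrite Normc.normc0 ltW // divr_gt0.
exists (r / 2), (8 * M / r); split=> [|v vr]; first by rewrite divr_gt0.
pose y := v + (- v 0 j) *: delta_mx 0 j.
have yj : (p + y) 0 j = 0 by rewrite mxE pj add0r coord_line eqxx subrr.
have yr i : N (y 0 i) <= 2 * r.
  rewrite coord_line; case: eqP => [->|_]; last by rewrite addr0; have := vr i; lra.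
  by rewrite subrr Normc.normc0 mulr_ge0 // ltW.
have By : box_bound f (p + y) (2 * r) M.
  by apply: (@box_bound_sub _ _ (2 * r)) => //; rewrite (_ : _ + _ = r1) // /r; field.
have E : p + v = p + y + v 0 j *: delta_mx 0 j.
  by rewrite /y -!addrA -scalerDl addNr scale0r addr0.
have [h1 _ h3] := coord_quotient_estimate r0 By yj (vr j).
have [vj|vj] := eqVneq (v 0 j) 0.
  rewrite E vj scale0r addr0; apply: le_trans h1 _.
  have M0 := annulus_bound_ge0 r0 (line_bound j r0 By).
  by apply: ler_wpM2r; [rewrite invr_ge0 ltW|lra].
have vj0 : 0 < N (v 0 j) by rewrite normc_gt0.
have pvj : (p + v) 0 j = v 0 j by rewrite mxE pj add0r.
rewrite /coord_quotient pvj (negbTE vj) Normc.normcM Normc.normcV ler_pdivrMr //.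
by rewrite E.
Qed.

End Quotient.

Theorem holomorphic_division f j : holomorphic f -> (forall x, x 0 j = 0 -> f x = 0) ->
  exists2 g, holomorphic g & forall x, f x = x 0 j * g x.
Proof.
move=> fh f0; exists (coord_quotient f j); last exact: coord_quotientP.
move=> p; have [r [M [r0 B]]] := coord_quotient_bound fh f0 p.
apply: (@osgood R _ p (r / 2) M) => [q k||].
- exact: coord_quotient_entire.
- by rewrite divr_gt0.
- by rewrite (_ : 2 * (r / 2) = r) //; field.
Qed.

Lemma holomorphic_eq f g j : holomorphic f -> holomorphic g ->
  (forall x, x 0 j != 0 -> f x = g x) -> f = g.
Proof.
move=> fh gh E; apply/funext => x; have [xj|] := eqVneq (x 0 j) 0; last exact: E.
apply/eqP; rewrite -subr_eq0 -normc_eq0; apply/eqP/le_anti.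
rewrite normc_ge0 andbT leNgt; apply/negP => e0.
pose h := fun t => axis_line f x j t - axis_line g x j t.
have dh : differentiable h 0 by apply: differentiableB; exact: axis_line_entire.
have [d d0 H] := continuous_bounded e0 dh.
have Nd : N (d / 2)%:C = d / 2 by rewrite normc_real gtr0_norm // divr_gt0.
have := H (d / 2)%:C; rewrite Nd => /(_ ltac:(lra)).
rewrite add0r /h /axis_line scale0r addr0 E; last first.
  by rewrite coord_line eqxx xj add0r -normc_eq0 Nd gt_eqF // divr_gt0.
by rewrite subrr sub0r normcN ltxx.
Qed.

(** On the projective line O(-2) has no sections: r(z) is O(1/z^2) at infinity, so
    the bound on large squares kills it everywhere. *)
Lemma no_section_Ominus2 (r r' : C -> C) : entire r -> entire r' ->
  (forall z, z != 0 -> r' z^-1 = z ^+ 2 * r z) -> forall w, r' w = 0.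
Proof.
move=> dr dr' E.
have [d d0 H] := continuous_bounded (@ltr01 R) (dr' 0).
pose M := N (r' 0) + 1.
have M0 : 0 < M by rewrite ltr_wpDl ?normc_ge0.
have rM z : d^-1 < N z -> N (r z) <= M / N z ^+ 2.
  move=> zd; have z0 : 0 < N z by apply: lt_trans zd; rewrite invr_gt0.
  have zn0 : z != 0 by rewrite -normc_gt0.
  rewrite ler_pdivlMr ?exprn_gt0 // mulrC -normcX -Normc.normcM -E //.
  have := H z^-1; rewrite add0r Normc.normcV invf_plt ?posrE // => /(_ zd) Hz.
  by have := normcD (r' z^-1 - r' 0) (r' 0); rewrite subrK /M; lra.
have r0 t : r t = 0.
  apply/eqP; rewrite -normc_eq0; apply/eqP/le_anti; rewrite normc_ge0 andbT.
  pose s0 := Num.max 1 (Num.max (2 * N t) (2 * d^-1)).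
  apply: (@le0_archi R _ (8 * M) s0) => s; rewrite /s0 !ge_max => /andP[s1 /andP[s2 s3]].
  have sp : 0 < s by exact: lt_le_trans s1.
  have B : annulus_bound r s (M / s ^+ 2).
    move=> z /andP[sz _]; apply: le_trans (rM z _) _.
      have : 0 < d^-1 by rewrite invr_gt0.
      by lra.
    apply: ler_wpM2l; first exact: ltW.
    have z0 : 0 < N z := lt_le_trans sp sz.
    by rewrite lef_pV2 ?posrE ?exprn_gt0 // lerXn2r ?nnegrE ?(ltW sp) ?(ltW z0).
  have ts : N t <= s / 2 by lra.
  have := cauchy_sup dr sp B ts; rewrite -ler_pdivlMr //.
  move=> /le_trans; apply; rewrite -mulrA; apply: ler_wpM2l => //.
  apply: ler_wpM2l; first exact: ltW.
  rewrite lef_pV2 ?posrE ?exprn_gt0 // expr2; nra.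
have r'0 w : w != 0 -> r' w = 0.
  by move=> w0; rewrite -[w]invrK E ?invr_eq0 // r0 mulr0.
move=> w; have [->|] := eqVneq w 0; last exact: r'0.
apply/eqP; rewrite -normc_eq0; apply/eqP/le_anti; rewrite normc_ge0 andbT.
rewrite leNgt; apply/negP => e0.
have [e ep He] := continuous_bounded e0 (dr' 0).
have Ne : N (e / 2)%:C = e / 2 by rewrite normc_real gtr0_norm // divr_gt0.
have := He (e / 2)%:C; rewrite Ne => /(_ ltac:(lra)).
rewrite add0r r'0; first by rewrite sub0r normcN ltxx.
by rewrite -normc_eq0 Ne gt_eqF // divr_gt0.
Qed.

End Division.

(** * Functions and bivector fields on the two charts *)

Local Notation glue := Defs.glue.

Section Sections.
Variable R : realType.
Local Notation C := R[i].
Local Notation V := 'rV[R[i]]_3.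
Implicit Types (f g : V -> C) (x y : V) (j : 'I_3).

Lemma holomorphic_const (k : C) : holomorphic (fun _ : V => k).
Proof. exact: (@holomorphic_cst C k). Qed.

Lemma holomorphic_row3 f (p q r : V -> C) : holomorphic f ->
  holomorphic p -> holomorphic q -> holomorphic r ->
  holomorphic (fun x => f (row3 (p x) (q x) (r x))).
Proof.
move=> fh ph qh rh x.
apply: (@differentiable_comp _ _ _ _ (fun x => row3 (p x) (q x) (r x)) f); last exact: fh.
have -> : (fun x => row3 (p x) (q x) (r x)) = fun x =>
    p x *: delta_mx 0 0 + (q x *: delta_mx 0 1 + r x *: delta_mx 0 2).
  apply/funext => y; apply/rowP; apply: ord3_ind;
  by rewrite !mxE /= ?(mulr0, mulr1, addr0, add0r).
by do ?[apply: differentiableD]; apply: differentiableZl; [exact: ph|exact: qh|exact: rh].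
Qed.

Lemma holomorphicD f g : holomorphic f -> holomorphic g ->
  holomorphic (fun x => f x + g x).
Proof. by move=> fh gh x; apply: differentiableD; [exact: fh|exact: gh]. Qed.

Lemma holomorphicB f g : holomorphic f -> holomorphic g ->
  holomorphic (fun x => f x - g x).
Proof. by move=> fh gh x; apply: differentiableB; [exact: fh|exact: gh]. Qed.

Lemma glue_involutive x : x 0 0 != 0 -> glue (glue x) = x.
Proof.
move=> x0; apply/rowP; apply: ord3_ind; rewrite !glueE ?invrK //; by field.
Qed.

Lemma glue_neq0 x : x 0 0 != 0 -> glue x 0 0 != 0.
Proof. by rewrite glueE invr_eq0. Qed.

Lemma glue_row3 (a b c : C) : glue (row3 a b c) = row3 a^-1 (a * b) (a * c).
Proof. by rewrite /glue !row3E. Qed.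

Lemma glue_row x : glue x = row3 (x 0 0)^-1 (x 0 0 * x 0 1) (x 0 0 * x 0 2).
Proof. by []. Qed.

Lemma glue_coord x j : j != 0 -> glue x 0 j = x 0 0 * x 0 j.
Proof. by elim/ord3_ind: j => // _; rewrite glueE. Qed.

(** Sections are determined by the chart U, whose image is dense in V. *)
Lemma W1fun_eq (s t : W1fun C) : (forall x, s.1 x = t.1 x) -> s = t.
Proof.
move=> E; have [s1 s2 sE] := W1funP s; have [t1 t2 tE] := W1funP t.
apply: val_inj; rewrite /= [LHS]surjective_pairing [RHS]surjective_pairing.
congr (_, _); first exact/funext.
apply: (holomorphic_eq (j := 0) s2 t2) => y y0.
by rewrite -(glue_involutive y0) -sE ?glue_neq0 // -tE ?glue_neq0.
Qed.

Lemma W1bivec_eq (s t : W1bivec C) : (forall x, s.1 x = t.1 x) -> s = t.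
Proof.
move=> E; have [s1 [_ s2] sE] := W1bivecP s; have [t1 [_ t2] tE] := W1bivecP t.
apply: val_inj; rewrite /= [LHS]surjective_pairing [RHS]surjective_pairing.
congr (_, _); first exact/funext.
apply/funext => y; apply/matrixP => i k.
have Ey (z : V) : z 0 0 != 0 -> s.2 z i k = t.2 z i k.
  move=> z0; rewrite -(glue_involutive z0).
  by rewrite (sE _ (glue_neq0 z0)) (tE _ (glue_neq0 z0)) E.
by have := congr1 (@^~ y) (holomorphic_eq (s2 i k) (t2 i k) Ey).
Qed.

Lemma W1fun_ex f1 f2 : is_W1fun (f1, f2) ->
  exists s : W1fun C, s.1 = f1 /\ s.2 = f2.
Proof. by move=> H; exists (MkW1fun (asboolT H)). Qed.

(** An identity between the charts may be checked off the hyperplane x_j = 0, which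
    allows cancelling the coordinate x_j. *)
Lemma overlap_eq f f' (phi : C -> C) j : j != 0 -> holomorphic f -> holomorphic f' ->
  (forall x, x 0 0 != 0 -> x 0 j != 0 -> phi (x 0 0) * f x = f' (glue x)) ->
  forall x, x 0 0 != 0 -> phi (x 0 0) * f x = f' (glue x).
Proof.
move=> j0 fh fh' H x x0; set z := x 0 0.
have h1 : holomorphic (fun w : V => phi z * f (row3 z (w 0 1) (w 0 2))).
  apply: holomorphicM; first exact: holomorphic_const.
  by apply: (holomorphic_row3 fh); [exact: holomorphic_const|exact: holomorphic_coord..].
have h2 : holomorphic (fun w : V => f' (row3 z^-1 (z * w 0 1) (z * w 0 2))).
  apply: (holomorphic_row3 fh'); first exact: holomorphic_const.
    by apply: holomorphicM; [exact: holomorphic_const|exact: holomorphic_coord].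
  by apply: holomorphicM; [exact: holomorphic_const|exact: holomorphic_coord].
have E : forall w : V, w 0 j != 0 -> phi z * f (row3 z (w 0 1) (w 0 2)) =
    f' (row3 z^-1 (z * w 0 1) (z * w 0 2)).
  move=> w wj; have := H (row3 z (w 0 1) (w 0 2)).
  rewrite glue_row3 row3E; apply => //.
  by elim/ord3_ind: j j0 wj {H} => // _; rewrite row3E.
have := congr1 (@^~ x) (holomorphic_eq h1 h2 E).
by rewrite /= /z -row3_eta -glue_row.
Qed.

(** Dividing by a fibre coordinate on both charts multiplies the transition function
    by 1/z, because v_j = z u_j. *)
Lemma divide_sections f f' (phi : C -> C) j : j != 0 ->
  holomorphic f -> holomorphic f' ->
  (forall x, x 0 0 != 0 -> f' (glue x) = phi (x 0 0) * f x) ->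
  (forall x, x 0 j = 0 -> f x = 0) -> (forall y, y 0 j = 0 -> f' y = 0) ->
  exists q q' : V -> C, [/\ holomorphic q /\ holomorphic q',
    forall x, f x = x 0 j * q x, forall y, f' y = y 0 j * q' y &
    forall x, x 0 0 != 0 -> q' (glue x) = (x 0 0)^-1 * phi (x 0 0) * q x].
Proof.
move=> j0 fh fh' E f0 f0'.
have [q qh qE] := holomorphic_division fh f0.
have [q' qh' qE'] := holomorphic_division fh' f0'.
exists q, q'; split=> // x x0; apply/esym; move: x x0.
apply: (overlap_eq (phi := fun z => z^-1 * phi z) j0 qh qh') => x x0 xj.
have : x 0 0 * x 0 j * q' (glue x) = phi (x 0 0) * (x 0 j * q x).
  by rewrite -qE -E // qE' glue_coord.
move=> H; apply: (mulfI (mulf_neq0 x0 xj)); rewrite H; by field.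
Qed.

(** The pair (f, f') is a section of the pullback of O(1).  The section 1 vanishes on
    xi = 0, so the coefficient of the section z is read off there. *)
Lemma split_O1 f f' : holomorphic f -> holomorphic f' ->
  (forall x, x 0 0 != 0 -> f' (glue x) = - (x 0 0)^-1 * f x) ->
  exists s t : W1fun C, forall x, f x = s.1 x + x 0 0 * t.1 x.
Proof.
move=> fh fh' E.
have hc k : holomorphic (fun x : V => x 0 k) by exact: holomorphic_coord.
have tU : holomorphic (fun x : V => - f' (row3 0 (x 0 0 * x 0 1) (x 0 0 * x 0 2))).
  apply: holomorphicN; apply: (holomorphic_row3 fh'); first exact: holomorphic_const.
    by apply: holomorphicM; exact: hc.
  by apply: holomorphicM; exact: hc.
have tV : holomorphic (fun y : V => - f' (row3 0 (y 0 1) (y 0 2))).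
  by apply: holomorphicN; apply: (holomorphic_row3 fh'); [exact: holomorphic_const|exact: hc..].
have [t [tE1 tE2]] : exists t : W1fun C,
    t.1 = (fun x : V => - f' (row3 0 (x 0 0 * x 0 1) (x 0 0 * x 0 2))) /\
    t.2 = (fun y : V => - f' (row3 0 (y 0 1) (y 0 2))).
  by apply: W1fun_ex; split; [exact: tU|exact: tV|move=> x x0 /=; rewrite !glueE].
have [_ _ tE] := W1funP t.
have [q qh qE] : exists2 q, holomorphic q & forall y, f' y + t.2 y = y 0 0 * q y.
  apply: holomorphic_division; first by apply: (holomorphicD fh'); rewrite tE2; exact: tV.
  by move=> y y0; rewrite tE2 {1}(row3_eta y) y0 subrr.
have [s [sE1 sE2]] : exists s : W1fun C,
    s.1 = (fun x => f x - x 0 0 * t.1 x) /\ s.2 = (fun y => - q y).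
  apply: W1fun_ex; split=> /=.
  - apply: (holomorphicB fh); apply: holomorphicM; first exact: hc.
    by rewrite tE1; exact: tU.
  - exact: holomorphicN.
  - move=> x x0; have := qE (glue x); rewrite E // -tE // glueE => H.
    apply: (mulfI (invr_neq0 x0)); rewrite mulrN -H; by field.
by exists s, t => x; rewrite sE1 subrK.
Qed.

(** A section of the pullback of O(-2) vanishes on the zero section, and so lies in
    the ideal (u1, u2); its cofactors are sections of O(-1), which means that
    they remain global after multiplication by z. *)
Lemma split_Ominus2 f f' : holomorphic f -> holomorphic f' ->
  (forall x, x 0 0 != 0 -> f' (glue x) = x 0 0 ^+ 2 * f x) ->
  exists s1 s2 t1 t2 : W1fun C, forall x,
    [/\ f x = x 0 1 * s1.1 x + x 0 2 * s2.1 x,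
        t1.1 x = x 0 0 * s1.1 x & t2.1 x = x 0 0 * s2.1 x].
Proof.
move=> fh fh' E.
have hc k : holomorphic (fun x : V => x 0 k) by exact: holomorphic_coord.
have h0 : holomorphic (fun x : V => 0 : C) by exact: holomorphic_const.
have axis g : holomorphic g -> holomorphic (fun x => g (row3 (x 0 0) 0 0)).
  by move=> gh; exact: (holomorphic_row3 gh (hc 0) h0 h0).
have ent g : holomorphic g -> entire (fun z => g (row3 z 0 0)).
  move=> gh; have -> : (fun z => g (row3 z 0 0)) = axis_line g 0 0.
    apply/funext => z; rewrite /axis_line add0r; congr g; apply/rowP.
    by apply: ord3_ind; rewrite !mxE /= ?mulr1 ?mulr0.
  exact: axis_line_entire.
have v0 w : f' (row3 w 0 0) = 0.
  apply: (no_section_Ominus2 (ent _ fh) (ent _ fh')) => z z0 /=.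
  by have := E (row3 z 0 0); rewrite glue_row3 !mulr0 row3E => /(_ z0).
have u0 : (fun x => f (row3 (x 0 0) 0 0)) = (fun x : V => 0 : C).
  apply: (holomorphic_eq (j := 0) (axis _ fh) h0) => x x0.
  have := E (row3 (x 0 0) 0 0); rewrite glue_row3 !mulr0 row3E v0 => /(_ x0).
  by move=> /esym/eqP; rewrite mulf_eq0 expf_eq0 (negbTE x0) /= => /eqP.
pose g x := f (row3 (x 0 0) 0 (x 0 2)).
pose g' y := f' (row3 (y 0 0) 0 (y 0 2)).
have gh : holomorphic g := holomorphic_row3 fh (hc 0) h0 (hc 2).
have gh' : holomorphic g' := holomorphic_row3 fh' (hc 0) h0 (hc 2).
have gE x : x 0 0 != 0 -> g' (glue x) = x 0 0 ^+ 2 * g x.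
  move=> x0; have := E (row3 (x 0 0) 0 (x 0 2)).
  by rewrite glue_row3 !row3E mulr0 /g' !glueE => /(_ x0).
have D h h' j : j != 0 -> holomorphic h -> holomorphic h' ->
    (forall x, x 0 0 != 0 -> h' (glue x) = x 0 0 ^+ 2 * h x) ->
    (forall x, x 0 j = 0 -> h x = 0) -> (forall x, x 0 j = 0 -> h' x = 0) ->
    exists s t : W1fun C, forall x, h x = x 0 j * s.1 x /\ t.1 x = x 0 0 * s.1 x.
  move=> j0 hh hh' hE hz hz'.
  have [q [q' [[qh qh'] qE qE' qq]]] :=
    divide_sections (phi := fun z => z ^+ 2) j0 hh hh' hE hz hz'.
  have [s [sE _]] : exists s : W1fun C, s.1 = q /\ s.2 = fun y => y 0 0 * q' y.
    apply: W1fun_ex; split; [exact: qh|exact: (holomorphicM (hc 0) qh')|].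
    by move=> x x0 /=; rewrite glueE qq //; field.
  have [t [tE _]] : exists t : W1fun C, t.1 = (fun x => x 0 0 * q x) /\ t.2 = q'.
    apply: W1fun_ex; split; [exact: (holomorphicM (hc 0) qh)|exact: qh'|].
    by move=> x x0 /=; rewrite qq //; field.
  by exists s, t => x; rewrite sE tE.
have [|||||s1 [t1 H1]] := D (fun x => f x - g x) (fun y => f' y - g' y) 1 isT.
- exact: holomorphicB.
- exact: holomorphicB.
- by move=> x x0; rewrite E // gE // mulrBr.
- by move=> x x1; rewrite /g {1}(row3_eta x) x1 subrr.
- by move=> x x1; rewrite /g' {1}(row3_eta x) x1 subrr.
have [|||||s2 [t2 H2]] := D g g' 2 isT.
- exact: gh.
- exact: gh'.
- exact: gE.
- by move=> x x2; rewrite /g x2; exact: (congr1 (@^~ x) u0).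
- by move=> x x2; rewrite /g' x2.
exists s1, s2, t1, t2 => x; have [a1 b1] := H1 x; have [a2 b2] := H2 x.
by split=> //; rewrite -a1 -a2 subrK.
Qed.

Lemma bivec_eta (B : 'M[C]_3) : B^T = - B -> B = bivec (B 1 2) (B 2 0) (B 0 1).
Proof.
move=> BT.
have A i k : B i k = - B k i by have := congr1 (fun M : 'M[C]_3 => M k i) BT; rewrite !mxE.
have diag i : B i i = 0.
  apply/eqP; have := A i i => /eqP; rewrite -addr_eq0 -mulr2n -mulr_natl mulf_eq0.
  by rewrite pnatr_eq0.
apply/matrixP; apply: ord3_ind; apply: ord3_ind; rewrite bivecE /= ?diag //; exact: A.
Qed.

Lemma bivec_inj (a b c a' b' c' : C) : bivec a b c = bivec a' b' c' ->
  [/\ a = a', b = b' & c = c'].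
Proof.
move=> E; split.
- have := congr1 (fun M : 'M[C]_3 => M 1 2) E; rewrite !bivecE /=; exact.
- have := congr1 (fun M : 'M[C]_3 => M 2 0) E; rewrite !bivecE /=; exact.
- have := congr1 (fun M : 'M[C]_3 => M 0 1) E; rewrite !bivecE /=; exact.
Qed.

Lemma W1combE (a1 a2 a3 a4 : W1fun C) (m1 m2 m3 m4 : W1bivec C) x :
  ((a1 *: m1 + a2 *: m2 + a3 *: m3 + a4 *: m4).1 x =
    a1.1 x *: m1.1 x + a2.1 x *: m2.1 x + a3.1 x *: m3.1 x + a4.1 x *: m4.1 x) *
  ((a1 *: m1 + a2 *: m2 + a3 *: m3 + a4 *: m4).2 x =
    a1.2 x *: m1.2 x + a2.2 x *: m2.2 x + a3.2 x *: m3.2 x + a4.2 x *: m4.2 x).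
Proof. by []. Qed.

Lemma W1bivecBE (m n : W1bivec C) x : (m - n).1 x = m.1 x - n.1 x.
Proof. by []. Qed.

Lemma W1funDE (s t : W1fun C) x : (s + t).1 x = s.1 x + t.1 x.
Proof. by []. Qed.

Lemma W1funNE (s : W1fun C) x : (- s).1 x = - s.1 x.
Proof. by []. Qed.

Lemma W1funME (s t : W1fun C) x : (s * t).1 x = s.1 x * t.1 x.
Proof. by []. Qed.

Lemma bivecD (a b c a' b' c' : C) :
  bivec a b c + bivec a' b' c' = bivec (a + a') (b + b') (c + c').
Proof.
rewrite /bivec /=; move: (wedge _ _) (wedge _ _) (wedge _ _) => X Y Z.
by rewrite !scalerDl [LHS]addrACA; congr (_ + _); exact: addrACA.
Qed.

Lemma bivecZ (k a b c : C) : k *: bivec a b c = bivec (k * a) (k * b) (k * c).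
Proof.
rewrite /bivec /=; move: (wedge _ _) (wedge _ _) (wedge _ _) => X Y Z.
by rewrite !scalerDr !scalerA.
Qed.

Lemma bivec0 : bivec 0 0 0 = 0 :> 'M[C]_3.
Proof.
rewrite /bivec /=; move: (wedge _ _) (wedge _ _) (wedge _ _) => X Y Z.
by rewrite !scale0r !addr0.
Qed.

Lemma bivec_step (k a b c p q r : C) (M L : 'M[C]_3) :
  L = bivec p q r -> M = bivec a b c ->
  L + k *: M = bivec (p + k * a) (q + k * b) (r + k * c).
Proof. by move=> -> ->; rewrite bivecZ bivecD. Qed.

Lemma bivec_comb4 (k1 k2 k3 k4 a1 b1 c1 a2 b2 c2 a3 b3 c3 a4 b4 c4 : C)
    (M1 M2 M3 M4 : 'M[C]_3) :
  M1 = bivec a1 b1 c1 -> M2 = bivec a2 b2 c2 -> M3 = bivec a3 b3 c3 ->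
  M4 = bivec a4 b4 c4 ->
  k1 *: M1 + k2 *: M2 + k3 *: M3 + k4 *: M4 =
  bivec (k1 * a1 + k2 * a2 + k3 * a3 + k4 * a4)
        (k1 * b1 + k2 * b2 + k3 * b3 + k4 * b4)
        (k1 * c1 + k2 * c2 + k3 * c3 + k4 * c4).
Proof.
move=> E1 E2 E3 E4; apply: bivec_step E4; apply: bivec_step E3.
by apply: bivec_step E2; rewrite E1 bivecZ.
Qed.

Lemma combination_U (a1 a2 a3 a4 : W1fun C) x :
  (a1 *: e1 C + a2 *: e2 C + a3 *: e3 C + a4 *: e4 C).1 x =
  bivec (x 0 1 * a3.1 x + x 0 2 * a4.1 x) (a1.1 x + x 0 0 * a3.1 x)
        (a2.1 x + x 0 0 * a4.1 x).
Proof.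
apply: etrans (W1combE _ _ _ _ _ _ _ _ _).1 _.
apply: etrans (@bivec_comb4 _ _ _ _ 0 1 0 0 0 1 (x 0 1) (x 0 0) 0 (x 0 2) 0 (x 0 0)
  _ _ _ _ erefl erefl erefl erefl) _.
by congr bivec; ring.
Qed.

Lemma combination_V (a1 a2 a3 a4 : W1fun C) y :
  (a1 *: e1 C + a2 *: e2 C + a3 *: e3 C + a4 *: e4 C).2 y =
  bivec (- y 0 1 * a1.2 y - y 0 2 * a2.2 y) (- y 0 0 * a1.2 y - a3.2 y)
        (- y 0 0 * a2.2 y - a4.2 y).
Proof.
apply: etrans (W1combE _ _ _ _ _ _ _ _ _).2 _.
apply: etrans (@bivec_comb4 _ _ _ _ (- y 0 1) (- y 0 0) 0 (- y 0 2) 0 (- y 0 0)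
  0 (- 1) 0 0 0 (- 1) _ _ _ _ erefl erefl erefl erefl) _.
by congr bivec; ring.
Qed.

Lemma W1bivec_components (m : W1bivec C) : exists a b c a' b' c' : V -> C,
  [/\ (forall x, m.1 x = bivec (a x) (b x) (c x)),
      [/\ holomorphic a, holomorphic b & holomorphic c],
      [/\ holomorphic a', holomorphic b' & holomorphic c'] &
      forall x, x 0 0 != 0 -> [/\
        a' (glue x) = x 0 0 ^+ 2 * a x - x 0 0 * x 0 1 * b x - x 0 0 * x 0 2 * c x,
        b' (glue x) = - (x 0 0)^-1 * b x & c' (glue x) = - (x 0 0)^-1 * c x]].
Proof.
have [[m1a m1h] [m2a m2h] mE] := W1bivecP m.
exists (fun x => m.1 x 1 2), (fun x => m.1 x 2 0), (fun x => m.1 x 0 1).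
exists (fun x => m.2 x 1 2), (fun x => m.2 x 2 0), (fun x => m.2 x 0 1).
split=> //; first by move=> x; exact: bivec_eta.
move=> x x0; have := mE x x0; rewrite {1}(bivec_eta (m2a (glue x))).
by rewrite {1}(bivec_eta (m1a x)) push_bivec_glue // => /bivec_inj.
Qed.

Lemma generation (m : W1bivec C) : exists a1 a2 a3 a4 : W1fun C,
  m = a1 *: e1 C + a2 *: e2 C + a3 *: e3 C + a4 *: e4 C.
Proof.
have [a [b [c [a' [b' [c' [mE [ah bh ch] [ah' bh' ch'] E]]]]]]] := W1bivec_components m.
have [x x0|s1 [t1 H1]] := split_O1 bh bh'; first by have [] := E x x0.
have [x x0|s2 [t2 H2]] := split_O1 ch ch'; first by have [] := E x x0.
pose n := m - (s1 *: e1 C + s2 *: e2 C + t1 *: e3 C + t2 *: e4 C).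
have [r [b1 [c1 [r' [b1' [c1' [nE [rh _ _] [rh' _ _] En]]]]]]] := W1bivec_components n.
have rE x : [/\ r x = a x - (x 0 1 * t1.1 x + x 0 2 * t2.1 x), b1 x = 0 & c1 x = 0].
  apply: bivec_inj; rewrite -nE /n W1bivecBE mE combination_U -H1 -H2.
  by rewrite -scaleN1r (bivec_step (-1) erefl erefl); congr bivec; ring.
have [x x0|w1 [w2 [z1 [z2 H3]]]] := split_Ominus2 rh rh'.
  by have [-> _ _] := En x x0; have [_ -> ->] := rE x; rewrite !mulr0 !subr0.
(* On U, z1 = z w1 and z2 = z w2: the correction adds r to the first component and
   leaves the other two unchanged. *)
exists (s1 - z1), (s2 - z2), (t1 + w1), (t2 + w2).
apply: W1bivec_eq => x; rewrite combination_U mE.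
have [h1 h2 h3] := H3 x; have [h4 _ _] := rE x.
rewrite !W1funDE !W1funNE.
rewrite H1 H2 h2 h3; congr bivec; last by ring.
  by move: h4; rewrite h1 => /eqP; rewrite eq_sym subr_eq => /eqP ->; ring.
by ring.
Qed.

(** Where x_1 = 0 the equation gives x_2 g = 0; cancel x_2 inside the hyperplane. *)
Lemma vanish_on_hyperplane f g : holomorphic g ->
  (forall x, x 0 1 * f x + x 0 2 * g x = 0) -> forall x, x 0 1 = 0 -> g x = 0.
Proof.
move=> gh E x x1.
have hc k : holomorphic (fun x : V => x 0 k) by exact: holomorphic_coord.
have h0 : holomorphic (fun x : V => 0 : C) by exact: holomorphic_const.
have gh0 := holomorphic_row3 gh (hc 0) h0 (hc 2).
have Z : (fun x => g (row3 (x 0 0) 0 (x 0 2))) = (fun x : V => 0 : C).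
  apply: (holomorphic_eq (j := 2) gh0 h0) => y y2.
  have := E (row3 (y 0 0) 0 (y 0 2)); rewrite !row3E mul0r add0r => /eqP.
  by rewrite mulf_eq0 (negbTE y2) => /eqP.
by rewrite (row3_eta x) x1; exact: (congr1 (@^~ x) Z).
Qed.

Lemma relations (a1 a2 a3 a4 : W1fun C) :
  a1 *: e1 C + a2 *: e2 C + a3 *: e3 C + a4 *: e4 C = 0 ->
  exists s : W1fun C, [/\ a1 = s * W1zu2 C, a2 = s * - W1zu1 C,
    a3 = s * - W1u2 C & a4 = s * W1u1 C].
Proof.
move=> E.
have EU x : [/\ x 0 1 * a3.1 x + x 0 2 * a4.1 x = 0, a1.1 x + x 0 0 * a3.1 x = 0 &
    a2.1 x + x 0 0 * a4.1 x = 0].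
  apply: bivec_inj; by rewrite -combination_U E bivec0.
have EV y : - y 0 1 * a1.2 y - y 0 2 * a2.2 y = 0.
  have [] // : [/\ - y 0 1 * a1.2 y - y 0 2 * a2.2 y = 0,
    - y 0 0 * a1.2 y - a3.2 y = 0 & - y 0 0 * a2.2 y - a4.2 y = 0].
  apply: bivec_inj; by rewrite -combination_V E bivec0.
have [h21 h22 h2] := W1funP a2; have [h31 h32 h3] := W1funP a3.
have [h41 h42 h4] := W1funP a4.
have z4 : forall x, x 0 1 = 0 -> a4.1 x = 0.
  by apply: (vanish_on_hyperplane (f := a3.1)) => // x; have [] := EU x.
have z2 : forall x, x 0 1 = 0 -> a2.2 x = 0.
  apply: (vanish_on_hyperplane (f := a1.2)) => // y; apply/eqP.
  by rewrite -oppr_eq0 opprD -mulNr EV.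
have glue24 x : x 0 0 != 0 -> a2.2 (glue x) = - x 0 0 * a4.1 x.
  move=> x0; rewrite -h2 //; have [_ _ /eqP] := EU x.
  by rewrite addr_eq0 mulNr => /eqP.
(* a4 on U and a2 on V are the two sides of one section, since a2 = - z a4 on U. *)
have [q [q' [[qh qh'] qE qE' qq]]] :=
  divide_sections (phi := fun z => - z) (isT : 1 != 0 :> 'I_3) h41 h22 glue24 z4 z2.
have [s [sE _]] : exists s : W1fun C, s.1 = q /\ s.2 = fun y => - q' y.
  apply: W1fun_ex; split; [exact: qh|exact: holomorphicN|].
  by move=> x x0 /=; rewrite qq //; field.
have hc k : holomorphic (fun x : V => x 0 k) by exact: holomorphic_coord.
have E3 x : a3.1 x = q x * - x 0 2.
  have hq : holomorphic (fun x : V => q x * - x 0 2).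
    exact: (holomorphicM qh (holomorphicN (hc 2))).
  have := congr1 (@^~ x) (holomorphic_eq (j := 1) h31 hq _); apply => y y1.
  have [H _ _] := EU y; apply: (mulfI y1).
  by move: H; rewrite qE => /eqP; rewrite addr_eq0 => /eqP ->; ring.
exists s; split; apply: W1fun_eq => x.
- rewrite W1funME /= sE.
  by have [_ /eqP] := EU x; rewrite addr_eq0 E3 => /eqP -> _; ring.
- rewrite W1funME W1funNE /= sE.
  by have [_ _ /eqP] := EU x; rewrite addr_eq0 qE => /eqP ->; ring.
- by rewrite W1funME W1funNE /= sE E3.
- by rewrite W1funME /= sE qE mulrC.
Qed.

Lemma relation_holds (s : W1fun C) :
  (s * W1zu2 C) *: e1 C + (s * - W1zu1 C) *: e2 C + (s * - W1u2 C) *: e3 C +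
  (s * W1u1 C) *: e4 C = 0.
Proof.
apply: W1bivec_eq => x; rewrite combination_U.
rewrite !W1funME !W1funNE; apply: etrans (bivec0).
by congr bivec => /=; ring.
Qed.

End Sections.

Theorem lemma3p1 (R : realType) :
  let e1 := e1 R[i] in let e2 := e2 R[i] in
  let e3 := e3 R[i] in let e4 := e4 R[i] in
  let u1 := W1u1 R[i] in let u2 := W1u2 R[i] in
  let zu1 := W1zu1 R[i] in let zu2 := W1zu2 R[i] in
  (forall m : W1bivec R[i], exists a1 a2 a3 a4 : W1fun R[i],
     m = a1 *: e1 + a2 *: e2 + a3 *: e3 + a4 *: e4) /\
  (forall a1 a2 a3 a4 : W1fun R[i],
     a1 *: e1 + a2 *: e2 + a3 *: e3 + a4 *: e4 = 0 <->
     exists s : W1fun R[i],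
       [/\ a1 = s * zu2, a2 = s * - zu1, a3 = s * - u2 & a4 = s * u1]).
Proof.
split=> [m|a1 a2 a3 a4]; first exact: generation.
split=> [|[s [-> -> -> ->]]]; first exact: relations.
exact: relation_holds.
Qed.
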